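(* Let $\Omega\subset\mathbb{R}^n$ be an open set and let $P(x,z)=z^d+\sum_{i=1}^{d}a_i(x)z^{d-i}$, where $a_i:\Omega\to\mathbb{R}$ are real analytic functions. Assume that for each $x\in\Omega$ all the roots of the polynomial $z\mapsto P(x,z)$ are real, and denote them, counted with multiplicity, by $\lambda_1(x)\le\dots\le\lambda_d(x)$. Then the mapping $\Lambda:\Omega\to\mathbb{R}^d$, $\Lambda(x)=(\lambda_1(x),\dots,\lambda_d(x))$, is locally Lipschitz.
   Context: Locally Lipschitz means: for any $x_0\in\Omega$ there exist $r>0$ and $L<\infty$ such that $|\lambda_i(x)-\lambda_i(y)|\le L|x-y|$ for all $i=1,\dots,d$ and all $x,y\in\Omega$ with $|x-x_0|<r$, $|y-x_0|<r$. *)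

(* Defs.v *)
From mathcomp Require Import all_boot all_order all_algebra.
From mathcomp Require Import finmap complex.
From mathcomp Require Import boolp classical_sets reals topology normedtype.
From mathcomp.analysis.showcase Require Import summability.

Set Implicit Arguments.
Unset Strict Implicit.
Unset Printing Implicit Defensive.

Import Order.TTheory GRing.Theory Num.Theory.
Import numFieldNormedType.Exports.

Local Open Scope classical_set_scope.
Local Open Scope ring_scope.

(* The library norm on 'rV[R]_n is the sup norm. *)
Definition enorm (R : realType) (n : nat) (v : 'rV[R]_n) : R :=
  Num.sqrt (\sum_(i < n) v 0 i ^+ 2).

Definition multimonomial (R : realType) (n : nat) (alpha : {ffun 'I_n -> nat})
    (v : 'rV[R]_n) : R :=
  \prod_(i < n) v 0 i ^+ alpha i.

(* The power series sum_alpha c_alpha (x - x0)^alpha is summed as an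
   unconditional (equivalently, absolutely convergent) family: its partial sums
   over finite sets of multi-indices converge along the filter of finite sets
   ordered by inclusion. *)
Definition analytic_at (R : realType) (n : nat) (f : 'rV[R]_n -> R)
    (x0 : 'rV[R]_n) : Prop :=
  exists c : {ffun 'I_n -> nat} -> R,
    \forall x \near x0,
      partial_sum (fun alpha => c alpha * multimonomial alpha (x - x0))
        @ totally --> f x.

Definition analytic_on (R : realType) (n : nat) (Omega : set 'rV[R]_n)
    (f : 'rV[R]_n -> R) : Prop :=
  forall x0, Omega x0 -> analytic_at f x0.

(* Indices start at 0: a i is the coefficient of z^(d - (i + 1)). *)
Definition monic_family (R : realType) (n d : nat)
    (a : 'I_d -> 'rV[R]_n -> R) (x : 'rV[R]_n) : {poly R} :=
  'X^d + \sum_(i < d) a i x *: 'X^(d - i.+1).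

Definition all_roots_real (R : realType) (p : {poly R}) : Prop :=
  forall z : R[i], root (map_poly (real_complex R) p) z -> complex.Im z = 0.

(* mup z p is the multiplicity of z as a root of p, 0 if z is not a root. *)
Definition ordered_roots (R : realType) (d : nat) (p : {poly R})
    (l : 'rV[R]_d) : Prop :=
  (forall i j : 'I_d, (i <= j)%N -> l 0 i <= l 0 j) /\
  (forall z : R, #|[pred i : 'I_d | l 0 i == z]| = mup z p).

Definition locally_lipschitz (R : realType) (n d : nat) (Omega : set 'rV[R]_n)
    (F : 'rV[R]_n -> 'rV[R]_d) : Prop :=
  forall x0, Omega x0 ->
    exists r L : R, 0 < r /\
      forall (i : 'I_d) (x y : 'rV[R]_n), Omega x -> Omega y ->
        enorm (x - x0) < r -> enorm (y - x0) < r ->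
        `|F x 0 i - F y 0 i| <= L * enorm (x - y).

(* Real-rootedness makes ordered_roots satisfiable, by exactly one vector. *)
Lemma ordered_roots_exist (R : realType) (d : nat) (p : {poly R}) :
  p \is monic -> size p = d.+1 -> all_roots_real p ->
  exists l : 'rV[R]_d, ordered_roots p l.
Proof.
move=> pm sp rp.
pose q := map_poly (real_complex R) p.
have [r Er] := closed_field_poly_normal q.
have qm : lead_coef q = 1 by rewrite lead_coef_map (monicP pm) rmorph1.
rewrite qm scale1r in Er.
pose s := sort <=%R [seq complex.Re z | z <- r].
have Erp : p = \prod_(z <- s) ('X - z%:P).
  apply: (@map_poly_inj _ _ (real_complex R)).
  rewrite -/q Er rmorph_prod /= (perm_big _ (permEl (perm_sort _ _))) /= big_map.
  rewrite big_seq [RHS]big_seq; apply: eq_bigr => z zr.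
  rewrite rmorphB /= map_polyX map_polyC /=.
  have /rp : root q z by rewrite Er root_prod_XsubC.
  by case: z {zr} => x y /= ->.
have ss : size s = d.
  by apply/eqP; rewrite -eqSS -sp Erp size_prod_XsubC.
have so : sorted <=%R s by apply: sort_sorted; exact: le_total.
exists (\row_i s`_i); split=> [i j ij|z].
  by rewrite !mxE; apply: le_sorted_leq_nth => //; rewrite inE ss.
have -> : mup z p = count_mem z s.
  rewrite Erp; elim: (s) => [|x t IH] /=.
    by rewrite big_nil mupNroot // root1.
  rewrite big_cons mupM ?polyXsubC_eq0 ?monic_neq0 ?monic_prod_XsubC //.
  by rewrite -(expr1 ('X - _)) mup_XsubCX IH eq_sym; case: eqP.
rewrite -sum1_card -sum1_count (big_nth 0) ss big_mkord.
by apply: eq_bigl => i; rewrite inE mxE.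
Qed.

Lemma ordered_roots_unique (R : realType) (d : nat) (p : {poly R})
    (l m : 'rV[R]_d) :
  ordered_roots p l -> ordered_roots p m -> l = m.
Proof.
have cnt (u : 'rV[R]_d) z :
    #|[pred i : 'I_d | u 0 i == z]| = count_mem z [seq u 0 i | i <- enum 'I_d].
  by rewrite count_map cardE size_filter enumT; apply: eq_count.
have srt (u : 'rV[R]_d) : (forall i j : 'I_d, (i <= j)%N -> u 0 i <= u 0 j) ->
    sorted <=%R [seq u 0 i | i <- enum 'I_d].
  move=> uh; rewrite sorted_map.
  have : sorted leq [seq val i | i <- enum 'I_d].
    by rewrite val_enum_ord iota_sorted.
  by rewrite sorted_map; apply: sub_sorted => i j; exact: uh.
move=> [/srt sl cl] [/srt sm cm].
have e : [seq l 0 i | i <- enum 'I_d] = [seq m 0 i | i <- enum 'I_d].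
  apply: (sorted_eq le_trans le_anti) => //.
  by apply/allP => z _; rewrite /= -!cnt cl cm.
by apply/rowP => i; move/eq_in_map: e; apply; rewrite mem_enum.
Qed.

(* Main.v *)
Require Import Defs.
From mathcomp Require Import all_boot all_order all_algebra.
From mathcomp Require Import finmap polyorder polyrcf ring lra.
From mathcomp Require Import boolp classical_sets reals topology normedtype.
From mathcomp.analysis.showcase Require Import summability.
Set Implicit Arguments.
Unset Strict Implicit.
Unset Printing Implicit Defensive.
Import Order.TTheory GRing.Theory Num.Theory.
Import numFieldNormedType.Exports.
Local Open Scope classical_set_scope.
Local Open Scope ring_scope.

(** The roots are compared along the segment joining two points near x0, so that
    the statement becomes one about polynomials P(t, z) of degree d in z, all of
    whose roots are real and whose coefficients have uniform Taylor expansions of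
    order N > d in the real parameter t (taylor_bounded). A bound for the Lipschitz
    constant of the roots in terms of d, of a bound for the roots and of the Taylor
    constants is proved by induction on d (lipschitz_roots).

    The critical points m_j(t), that is, the roots of the z-derivative of P, are
    real, interlace the roots l_i(t), and are Lipschitz by induction. Since they
    interlace, the sign of P(t, m_j(t)) is known: it alternates with j and does
    not depend on t. Write mu = m_j(0) and phi(t) for P(t, mu) with the sign for
    which phi(0) >= 0. As P_z vanishes at (t, m_j(t)) and m_j(t) - mu = O(t), the
    sign condition gives phi(t) >= - C A t^2 for small t, where A is the product of the
    distances from mu to the other critical points, which is |P_zz(0, mu)|/d. The
    opposite sign at the nearest other critical point, at distance D from mu, gives
    |phi| <= C A D^2 for |t| up to the order of D; by interpolation, this
    bounds the coefficients of the Taylor polynomial of phi at the scale D, and in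
    particular its second order terms by C A t^2. As in Glaeser's inequality for
    nonnegative functions, a function that is almost nonnegative with controlled
    second order terms has a small slope where it is small: if mu is at distance
    rho from a root, then phi(t) - phi(0) = O(A (rho |t| + t^2)). This is
    critical_value_increment.

    The roots are recovered from these estimates (root_increment_upper). Let z be
    the point at distance K|t| to the right of l_i(0), and suppose that no critical
    point is near. Comparing P at z with its value at the nearest critical point
    shows that P(t, z) - P(0, z) = O(|t| |P_z(0, z)|), whereas
    |P(0, z)| >= K|t| |P_z(0, z)|/d because z is at distance at least K|t| from all
    the roots. For K large P(t, z) has the sign of P(0, z), so l_i(t) <= z.
    If there is a critical point near, it bounds l_i(t) directly.

    Finally, an unconditionally convergent power series has bounded sums of
    absolute values on a cube, and expanding the monomials along a line gives the
    uniform Taylor expansions (analytic_line_taylor). *)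

(** * Bounding the coefficients of a polynomial by its size on an interval *)

(** By induction on N: g(t) - 2^N g(t/2) has no term of degree N and is bounded
    by (1 + 2^N) H, and its coefficient of degree k < N is that of g multiplied
    by 1 - 2^(N-k), of absolute value at least 1. *)
Lemma coef_bound_of_sup (R : realFieldType) (N : nat) :
  exists2 C : R, 0 <= C & forall (g : {poly R}) (tau H : R),
    (size g <= N)%N -> 0 < tau ->
    (forall t, `|t| <= tau -> `|g.[t]| <= H) ->
    forall k, `|g`_k| * tau ^+ k <= C * H.
Proof.
elim: N => [|N [C C0 IH]].
  exists 0 => // g tau H; rewrite leqn0 size_poly_eq0 => /eqP-> _ _ k.
  by rewrite coef0 normr0 !mul0r.
set c : R := C * (1 + 2 ^+ N).
have c0 : 0 <= c by rewrite mulr_ge0 // addr_ge0 // exprn_ge0.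
exists (1 + c + N%:R * c) => [|g tau H sg tau0 gH k].
  by rewrite !addr_ge0 // mulr_ge0.
have H0 : 0 <= H by apply: le_trans (gH 0 _); rewrite ?normr0 // ltW.
have cH0 : 0 <= c * H by rewrite mulr_ge0.
pose g' := \poly_(k < N) (g`_k * (1 - 2 ^+ (N - k))).
have g'E t : g'.[t] = g.[t] - 2 ^+ N * g.[t / 2].
  rewrite horner_poly !(horner_coef_wide _ sg) mulr_sumr -sumrB big_ord_recr /=.
  have -> : g`_N * t ^+ N - 2 ^+ N * (g`_N * (t / 2) ^+ N) = 0.
    by rewrite expr_div_n; field; rewrite expf_neq0 ?pnatr_eq0.
  rewrite addr0; apply: eq_bigr => i _; have iN := ltnW (ltn_ord i).
  have -> : 2 ^+ N = 2 ^+ (N - i) * 2 ^+ i :> R by rewrite -exprD subnK.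
  by rewrite expr_div_n; field; rewrite expf_neq0 ?pnatr_eq0.
have low j : (j < N)%N -> `|g`_j| * tau ^+ j <= c * H.
  move=> jN; apply: (@le_trans _ _ (`|g'`_j| * tau ^+ j)).
    rewrite ler_wpM2r ?exprn_ge0 ?(ltW tau0) // coef_poly jN normrM ler_peMr //.
    have : 2 <= 2 ^+ (N - j) :> R by rewrite ler_eXnr ?subn_gt0 ?ler1n.
    by move=> ?; rewrite distrC ger0_norm; lra.
  rewrite /c -mulrA; apply: IH => // [|t tt]; first exact: size_poly.
  rewrite g'E mulrDl mul1r (le_trans (ler_normB _ _)) // lerD ?gH //.
  rewrite normrM normrX normr_nat ler_wpM2l ?exprn_ge0 // gH //.
  by rewrite normrM normfV normr_nat; have := normr_ge0 t; lra.
have top : `|g`_N| * tau ^+ N <= H + N%:R * (c * H).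
  have tauE : g`_N * tau ^+ N = g.[tau] - \sum_(i < N) g`_i * tau ^+ i.
    by rewrite (horner_coef_wide _ sg) big_ord_recr /= addrC addrK.
  have tau_ge0 := ltW tau0.
  rewrite -[X in _ * X]ger0_norm ?exprn_ge0 // -normrM tauE.
  apply: (le_trans (ler_normB _ _)).
  apply: lerD; first by rewrite gH // ger0_norm.
  apply: (le_trans (ler_norm_sum _ _ _)).
  rewrite (@le_trans _ _ (\sum_(i < N) c * H)) //.
    apply: ler_sum => i _; rewrite normrM [ `|_ ^+ _|]ger0_norm ?exprn_ge0 //.
    exact: low.
  by rewrite sumr_const card_ord mulr_natl.
have N0 : 0 <= N%:R * (c * H) by rewrite mulr_ge0.
have -> : (1 + c + N%:R * c) * H = H + c * H + N%:R * (c * H) by ring.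
case: (ltngtP k N) => [/low|Nk|->]; [by lra| |by lra].
by rewrite nth_default ?normr0 ?mul0r ?(leq_trans sg) //; lra.
Qed.

(** * Products of linear factors and their critical points *)

(** Roots are indexed by nat, only the indices below d being meaningful; this
    lets interlacing speak of l j and l j.+1 without casts between ordinals. *)
Definition poly_of_roots (R : comNzRingType) (d : nat) (l : nat -> R) : {poly R} :=
  \prod_(i < d) ('X - (l i)%:P).

Lemma horner_poly_of_roots (R : comNzRingType) d (l : nat -> R) z :
  (poly_of_roots d l).[z] = \prod_(i < d) (z - l i).
Proof. by rewrite horner_prod; apply: eq_bigr => i _; rewrite !hornerE. Qed.

Lemma poly_of_roots_monic (R : comNzRingType) d (l : nat -> R) : poly_of_roots d l \is monic.
Proof. exact: monic_prod_XsubC. Qed.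

Lemma size_poly_of_roots (R : comNzRingType) d (l : nat -> R) :
  size (poly_of_roots d l) = d.+1.
Proof. by rewrite size_prod_XsubC /index_enum -enumT size_enum_ord. Qed.

Lemma prod_XsubC_dvdp (R : fieldType) (s : seq R) (p : {poly R}) : p != 0 ->
  (forall z, (count_mem z s <= mup z p)%N) -> \prod_(z <- s) ('X - z%:P) %| p.
Proof.
elim: s p => [|x s IH] p p0 cnt; first by rewrite big_nil dvd1p.
have : 'X - x%:P %| p by rewrite XsubC_dvd // (leq_trans _ (cnt x)) //= eqxx.
case/dvdpP => q pE; rewrite pE.
have q0 : q != 0 by apply: contraNneq p0 => q0; rewrite pE q0 mul0r.
rewrite big_cons mulrC dvdp_mul2r ?polyXsubC_eq0 //; apply: IH => // z.
have mX : mup z ('X - x%:P) = (x == z) by rewrite -(expr1 ('X - _)) mup_XsubCX; case: eqP.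
by have := cnt z; rewrite pE mupM ?polyXsubC_eq0 //= mX addnC leq_add2r.
Qed.

Lemma poly_of_rootsP (R : fieldType) d (l : nat -> R) (p : {poly R}) :
  p \is monic -> size p = d.+1 ->
  (forall z, (\sum_(i < d) (l i == z) <= mup z p)%N) -> p = poly_of_roots d l.
Proof.
move=> pm sp cnt.
have iotaE : iota 0 d = index_iota 0 d by rewrite /index_iota subn0.
have E : poly_of_roots d l = \prod_(z <- mkseq l d) ('X - z%:P).
  by rewrite big_map iotaE big_mkord.
apply/eqP; rewrite eq_sym -eqp_monic ?poly_of_roots_monic //.
rewrite -dvdp_size_eqp ?size_poly_of_roots ?sp // E.
apply: prod_XsubC_dvdp => [|z]; first by rewrite monic_neq0.
rewrite (leq_trans _ (cnt z)) // -sum1_count big_map iotaE big_mkcond big_mkord.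
by apply: leq_sum => i _ /=; case: eqP.
Qed.

Lemma mup_poly_of_roots (R : fieldType) d (l : nat -> R) z :
  mup z (poly_of_roots d l) = (\sum_(i < d) (l i == z))%N.
Proof.
elim: d => [|d IH]; first by rewrite /poly_of_roots !big_ord0 mupNroot // root1.
rewrite big_ord_recr -IH /poly_of_roots big_ord_recr /=.
rewrite mupM ?monic_neq0 ?monic_prod_XsubC ?monicXsubC //; congr (_ + _)%N.
by rewrite -(expr1 ('X - _)) mup_XsubCX; case: eqP.
Qed.

Lemma mup_deriv_geq (R : fieldType) (p : {poly R}) z :
  p != 0 -> p^`() != 0 -> (mup z p - 1 <= mup z p^`())%N.
Proof.
move=> p0 p'0; case E: (mup z p) => [//|k]; rewrite subn1 /= mup_geq //.
have : ('X - z%:P) ^+ k.+1 %| p by rewrite -mup_geq // E.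
case/dvdpP => q ->; rewrite derivM deriv_exp derivXsubC mul1r /=.
by rewrite dvdp_add // -?mulrnAr dvdp_mull // ?exprS ?dvdp_mull // -mulr_natr dvdp_mulr.
Qed.

Definition nondecreasing_upto (R : numDomainType) d (l : nat -> R) :=
  forall i j, (i <= j)%N -> (j < d)%N -> l i <= l j.

(** This counts multiplicities in Rolle's theorem: a root z of multiplicity k is
    the value of k consecutive l i, and at most k - 1 of the m j between them
    can be equal to z. *)
Lemma leq_count_consecutive (T : eqType) e (l m : nat -> T) z :
  (forall j, (j < e)%N -> m j = z -> l j = z /\ l j.+1 = z) ->
  (exists2 i, (i <= e)%N & l i = z) ->
  (1 + \sum_(j < e) (m j == z) <= \sum_(i < e.+1) (l i == z))%N.
Proof.
elim: e => [|e IH] ml [i ie li].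
  by move: ie li; rewrite leqn0 => /eqP-> l0; rewrite big_ord0 big_ord1 l0 eqxx.
rewrite big_ord_recr [leqRHS]big_ord_recr /= addnA.
have ml' j : (j < e)%N -> m j = z -> l j = z /\ l j.+1 = z by move/ltnW/ml.
have [ex|nex] := pselect (exists2 i, (i <= e)%N & l i = z).
  apply: leq_add; first exact: IH.
  by have [/eqP me|//] := boolP (m e == z); have [_ ->] := ml e (leqnn _) me; rewrite eqxx.
have m0 j : (j <= e)%N -> (m j == z) = false.
  move=> je; apply/eqP => mj; apply: nex; exists j => //.
  by have [] := ml j je mj.
rewrite m0 // addn0 big1 => [|j _]; last by rewrite m0 // ltnW.
move: ie; rewrite leq_eqVlt => /orP[/eqP ie|ie]; first by rewrite -{2}li ie eqxx addn1.
by case: nex; exists i.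
Qed.

(** Rolle's theorem with multiplicities. Between two equal consecutive roots m j
    is that root, otherwise it is a point given by Rolle's theorem; counting
    multiplicities shows that these e points exhaust the roots of the
    derivative, of degree e. *)
Lemma critical_points (R : rcfType) e (l : nat -> R) :
  nondecreasing_upto e.+1 l -> exists m : nat -> R,
    (forall j, (j < e)%N -> l j <= m j <= l j.+1) /\
    (poly_of_roots e.+1 l)^`() = e.+1%:R *: poly_of_roots e m.
Proof.
move=> lS; set p := poly_of_roots e.+1 l.
have choose_m j : exists c, (j < e)%N ->
    (l j = l j.+1 /\ c = l j) \/ (l j < c < l j.+1 /\ root p^`() c).
  have [je|] := ltnP j e; last by exists 0.
  have := lS _ _ (leqnSn j) je; rewrite le_eqVlt => /orP[/eqP E|lt].
    by exists (l j) => _; left.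
  have root_l i : (i < e.+1)%N -> p.[l i] = 0.
    move=> ie; rewrite /p horner_poly_of_roots (bigD1 (Ordinal ie)) //=.
    by rewrite subrr mul0r.
  have [|c cI rc] := poly_rolle lt (p := p); first by rewrite !root_l // ltnW.
  by exists c => _; right; split; [move: cI; rewrite in_itv | exact/eqP].
have [m mP] := choice choose_m; exists m.
have itl j : (j < e)%N -> l j <= m j <= l j.+1.
  move=> je; have := lS _ _ (leqnSn j) je.
  case: (mP j je) => [[-> ->] //|[/andP[a b] _] _]; first by rewrite lexx.
  by rewrite !ltW.
split => //.
have e0 : e.+1%:R != 0 :> R by rewrite pnatr_eq0.
have sp : size p = e.+2 by rewrite size_poly_of_roots.
have pm : p \is monic by rewrite poly_of_roots_monic.
have sp' : size p^`() = e.+1 by rewrite size_deriv sp.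
have p'0 : p^`() != 0 by rewrite -size_poly_eq0 sp'.
set q := e.+1%:R^-1 *: p^`(); suff -> : poly_of_roots e m = q.
  by rewrite scalerA mulfV // scale1r.
have sq : size q = e.+1 by rewrite size_scale ?invr_eq0.
have mupq z : mup z q = mup z p^`().
  by rewrite /q -mul_polyC mupMr // rootC invr_eq0.
apply/esym/poly_of_rootsP => // [|z].
  rewrite monicE lead_coefE sq /= coefZ coef_deriv; apply/eqP.
  have := monicP pm; rewrite lead_coefE sp /= => ->.
  by rewrite -mulr_natl mulr1 mulVf.
(* If z is a root of p, its multiplicity drops by one in p'; otherwise z
   occurs at most once among the m j, strictly between two roots of p. *)
rewrite mupq; have [zl|/existsPn zl] := boolP [exists i : 'I_e.+1, l i == z].
  rewrite (leq_trans _ (mup_deriv_geq z (monic_neq0 pm) p'0)) //.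
  rewrite mup_poly_of_roots leq_subRL; last first.
    by case/existsP: zl => i li; rewrite (bigD1 i) //= li.
  have mz j : (j < e)%N -> m j = z -> l j = z /\ l j.+1 = z.
    move=> je mj; case: (mP j je) => [[<- <-] //|[/andP[a b] _]].
    case/existsP: zl => i /eqP li; rewrite mj -li in a b.
    have [ij|ji] := leqP i j.
      by have := le_lt_trans (lS _ _ ij (ltnW je)) a; rewrite ltxx.
    by have := lt_le_trans b (lS _ _ ji (ltn_ord i)); rewrite ltxx.
  apply: leq_count_consecutive => //.
  by case/existsP: zl => i /eqP li; exists i => //; rewrite -ltnS.
have [/existsP[j mj]|/existsPn mN] := boolP [exists j : 'I_e, m j == z]; last first.
  by rewrite big1 // => j _; rewrite (negbTE (mN j)).
have lj k : (k < e.+1)%N -> l k <> z.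
  by move=> ke lk; have := zl (Ordinal ke); rewrite lk eqxx.
have mE k : (k < e)%N -> m k = z -> l k < z < l k.+1 /\ root p^`() z.
  move=> ke mk; case: (mP k ke) => [[_ E]|]; last by rewrite mk.
  by case: (lj k (ltnW ke)); rewrite -E.
rewrite (bigD1 j) //= mj big1 ?addn0.
  have [_ rz] := mE j (ltn_ord j) (eqP mj).
  by rewrite -XsubC_dvd // dvdp_XsubCl.
move=> k kj; apply/eqP; rewrite eqb0; apply/eqP => mk.
have [/andP[a b] _] := mE _ (ltn_ord k) mk.
have [/andP[a' b'] _] := mE _ (ltn_ord j) (eqP mj).
have [kj'|jk|kj'] := ltngtP k j.
- by have := lt_trans b (le_lt_trans (lS _ _ kj' (ltnW (ltn_ord j))) a'); rewrite ltxx.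
- by have := lt_trans b' (le_lt_trans (lS _ _ jk (ltnW (ltn_ord k))) a); rewrite ltxx.
- by move/eqP: kj; apply; apply: val_inj.
Qed.

(** * Values of a real-rooted polynomial near its critical points *)
Lemma poly_of_roots_sign (R : realDomainType) d (l : nat -> R) k (z : R) : (k <= d)%N ->
  (forall i, (i < k)%N -> l i <= z) -> (forall i, (k <= i < d)%N -> z <= l i) ->
  0 <= (-1) ^+ (d - k) * (poly_of_roots d l).[z].
Proof.
rewrite horner_poly_of_roots; elim: d => [|d IH] kd lo hi.
  by rewrite big_ord0 expr0 mulr1.
move: kd; rewrite leq_eqVlt => /orP[/eqP kE|kd].
  by rewrite kE subnn expr0 mul1r prodr_ge0 // => i _; rewrite subr_ge0 lo // kE.
rewrite big_ord_recr /= subSn // exprS mulN1r mulNr mulrA -mulrN opprB.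
rewrite mulr_ge0 ?IH // => [i /andP[ki id]|].
  by rewrite hi // ki ltnW.
by rewrite subr_ge0 hi // -ltnS kd /=.
Qed.

Lemma horner_increment (R : rcfType) (p : {poly R}) (x y H : R) :
  (forall w, `|w - x| <= `|x - y| -> `|w - y| <= `|x - y| -> `|p^`().[w]| <= H) ->
  `|p.[x] - p.[y]| <= H * `|x - y|.
Proof.
move=> pH; wlog xy : x y pH / x < y => [hw|].
  have [/hw|yx|->] := ltgtP x y; first exact; last by rewrite !subrr normr0 mulr0.
  rewrite distrC [ `|x - y|]distrC; apply: hw => // w a b.
  by apply: pH; rewrite [ `|x - y|]distrC.
have [c] := poly_mvt p xy; rewrite in_itv /= => /andP[xc cy] E.
rewrite distrC E normrM [ `|y - x|]distrC ler_wpM2r // pH //;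
  rewrite [ `|x - y|]ltr0_norm ?subr_lt0 // ler_norml; apply/andP; split; lra.
Qed.

(** The m j are the critical points of the product over the l i, listed so that
    they interlace the roots; this listing fixes the sign of each critical
    value, even at multiple roots. *)
Definition interlacing_critical (R : numDomainType) e (l m : nat -> R) :=
  (forall j, (j < e)%N -> l j <= m j <= l j.+1) /\
  (poly_of_roots e.+1 l)^`() = e.+1%:R *: poly_of_roots e m.

(** The mean value theorem, the derivative being bounded through the distances
    from x to the critical points m0 of another member of the family, delta
    being the distance that critical points have moved. *)
Lemma critical_increment (R : rcfType) e (l m m0 : nat -> R) (delta rho x y : R) :
  interlacing_critical e l m -> (forall k, (k < e)%N -> `|m0 k - m k| <= delta) ->
  `|x - y| <= rho ->
  `|(poly_of_roots e.+1 l).[x] - (poly_of_roots e.+1 l).[y]| <=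
    e.+1%:R * rho * \prod_(k < e) (`|x - m0 k| + (rho + delta)).
Proof.
move=> [_ P'] dm xy.
set F := \prod_(k < e) _.
have F0 : 0 <= F.
  apply: prodr_ge0 => k _; have := dm k (ltn_ord k).
  by have := normr_ge0 (m0 k - m k); have := normr_ge0 (x - y); have := normr_ge0 (x - m0 k); lra.
rewrite (@le_trans _ _ (e.+1%:R * F * `|x - y|)) //.
  apply: horner_increment => w wx _.
  rewrite P' hornerZ normrM normr_nat ler_wpM2l // horner_poly_of_roots normr_prod.
  apply: ler_prod => k _; rewrite normr_ge0 /=.
  have := dm k (ltn_ord k); have := ler_distD x w (m k); have := ler_distD (m0 k) x (m k).
  by lra.
by rewrite mulrAC ler_wpM2r // ler_wpM2l.
Qed.

(** At x = 0 and up to the factor e.+1 this is the absolute value of the second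
    derivative at the critical point m j; positive x are used to bound the
    first derivative at distance about x from m j. *)
Definition spread (R : numDomainType) e (m : nat -> R) j (x : R) : R :=
  \prod_(k < e | (k : nat) != j) (`|m j - m k| + x).

Lemma prod_spread (R : numDomainType) e (m : nat -> R) j x : (j < e)%N ->
  \prod_(k < e) (`|m j - m k| + x) = x * spread e m j x.
Proof. by move=> je; rewrite (bigD1 (Ordinal je)) //= subrr normr0 add0r. Qed.

Lemma spread_ge0 (R : numDomainType) e (m : nat -> R) j x : 0 <= x -> 0 <= spread e m j x.
Proof. by move=> x0; apply: prodr_ge0 => k _; rewrite addr_ge0. Qed.

Lemma spread_le_exp (R : realDomainType) e (m : nat -> R) j (c x D : R) : 0 <= c -> 0 <= x ->
  (forall k, (k < e)%N -> k != j -> D <= `|m j - m k|) -> x <= c * D ->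
  spread e m j x <= (1 + c) ^+ e * spread e m j 0.
Proof.
move=> c0 x0 Dm xD.
have c1 : 1 <= 1 + c by rewrite lerDl.
pose S := (1 + c) ^+ #|[pred k : 'I_e | (k : nat) != j]| * spread e m j 0.
apply: (@le_trans _ _ S).
  rewrite /S -prodr_const /spread -big_split /=; apply: ler_prod => k kj.
  rewrite addr_ge0 //= addr0 mulrDl mul1r lerD2l (le_trans xD) // ler_wpM2l //.
  exact: Dm.
rewrite ler_wpM2r ?spread_ge0 // ler_weXn2l //.
by rewrite (leq_trans (max_card _)) // card_ord.
Qed.

Lemma exp_le_spread (R : numDomainType) e (m : nat -> R) j (D : R) : (j < e)%N -> 0 <= D ->
  (forall k, (k < e)%N -> k != j -> D <= `|m j - m k|) -> D ^+ e.-1 <= spread e m j 0.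
Proof.
move=> je D0 Dm; have -> : e.-1 = #|[pred k : 'I_e | (k : nat) != j]|.
  have -> : #|[pred k : 'I_e | (k : nat) != j]| = #|predC1 (Ordinal je)| by apply: eq_card.
  by rewrite cardC1 card_ord.
rewrite -prodr_const; apply: ler_prod => k kj; rewrite D0 addr0 /=.
exact: Dm.
Qed.

Lemma critical_value_sign (R : realDomainType) e (l m : nat -> R) j :
  nondecreasing_upto e.+1 l -> interlacing_critical e l m -> (j < e)%N ->
  0 <= (-1) ^+ (e - j) * (poly_of_roots e.+1 l).[m j].
Proof.
move=> lS [lm _] je; rewrite -subSS; have /andP[lo hi] := lm j je.
apply: poly_of_roots_sign => [|i ij|i /andP[ji ie]]; first exact: ltnW.
  by apply: le_trans lo; apply: lS => //; exact: ltnW.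
by apply: (le_trans hi); apply: lS.
Qed.

(** The point m0 j is within delta of the critical point m j, where the signed
    value is nonnegative, and near which the derivative is O(delta). Hence the
    signed value at m0 j is negative by at most a multiple of delta^2. *)
Lemma critical_value_lower (R : rcfType) e (l m m0 : nat -> R) (delta : R) j :
  nondecreasing_upto e.+1 l -> interlacing_critical e l m ->
  (forall k, (k < e)%N -> `|m0 k - m k| <= delta) -> (j < e)%N ->
  - (e.+1%:R * delta * (2 * delta) * spread e m0 j (2 * delta)) <=
    (-1) ^+ (e - j) * (poly_of_roots e.+1 l).[m0 j].
Proof.
move=> lS lm dm je.
have := critical_value_sign lS lm je.
have := critical_increment lm dm (dm j je).
have -> : delta + delta = 2 * delta by ring.
rewrite prod_spread // !mulrA; set U := (_ * spread _ _ _ _).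
rewrite ler_norml -signr_odd => /andP[].
by case: odd; rewrite ?expr0 ?expr1; lra.
Qed.

(** Critical values at neighbouring critical points have opposite signs. Hence,
    if D is the distance from m0 j to the nearest other critical point, the value
    at m0 j is bounded on both sides by the increments towards the two critical
    points. For a single critical point (e = 1) there is no neighbour, and
    D = 2 B bounds the two factors of the value itself. *)
Lemma critical_value_bound (R : rcfType) e (m0 : nat -> R) (B : R) j :
  nondecreasing_upto e m0 -> (forall k, (k < e)%N -> `|m0 k| <= B) -> (j < e)%N ->
  exists D : R, [/\ 0 <= D <= 2 * B,
    forall k, (k < e)%N -> k != j -> D <= `|m0 j - m0 k| &
    forall (l m : nat -> R) (delta : R),
      nondecreasing_upto e.+1 l -> interlacing_critical e l m ->
      (forall i, (i < e.+1)%N -> `|l i| <= B) ->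
      (forall k, (k < e)%N -> `|m0 k - m k| <= delta) ->
      `|(poly_of_roots e.+1 l).[m0 j]| <=
        e.+1%:R * (D + 2 * delta) ^+ 2 * spread e m0 j (D + 2 * delta)].
Proof.
move=> mS mB je.
have B0 : 0 <= B by apply: le_trans (mB j je).
have delta_ge0 (m : nat -> R) (delta : R) : (forall k, (k < e)%N -> `|m0 k - m k| <= delta) ->
  0 <= delta by move=> dm; apply: le_trans (dm j je).
have [e1|e_gt1] := leqP e 1.
  have [? ?] : e = 1%N /\ j = 0%N by case: e j e1 je {mS mB delta_ge0} => [|[]] // [].
  subst e j.
  exists (2 * B); split; first by rewrite lexx andbT mulr_ge0.
    by case.
  move=> l m delta lS lm lB dm; have d0 : 0 <= delta by apply: le_trans (dm 0%N isT).
  rewrite horner_poly_of_roots normr_prod /spread big_ord_recr big_ord1 /=.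
  rewrite big1; last by case=> -[].
  rewrite mulr1; have m0B := mB 0%N isT.
  have B1 i : (i < 2)%N -> `|m0 0%N - l i| <= 2 * B.
    by move=> /lB; move: m0B; rewrite !ler_norml => /andP[? ?] /andP[? ?]; apply/andP; split; lra.
  apply: (le_trans (ler_pM _ _ (B1 0%N isT) (B1 1%N isT))) => //.
  have := mulr_ge0 B0 d0; have := mulr_ge0 d0 d0; have := mulr_ge0 B0 B0.
  by rewrite expr2 => ? ? ?; nra.
have [j' [j'e j'P nearest]] : exists j', [/\ (j' < e)%N, j' = j.+1 \/ j = j'.+1 &
    forall k, (k < e)%N -> k != j -> `|m0 j - m0 j'| <= `|m0 j - m0 k|].
  have below k : (k < j)%N -> `|m0 j - m0 j.-1| <= `|m0 j - m0 k|.
    case: j je => // j je kj; rewrite !ger0_norm ?subr_ge0 ?mS //.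
    - by rewrite lerD2l lerN2 mS // ltnW.
    - exact: ltnW.
  have above k : (j < k)%N -> (k < e)%N -> `|m0 j - m0 j.+1| <= `|m0 j - m0 k|.
    move=> jk ke; have j1e := leq_ltn_trans jk ke.
    by rewrite ![ `|m0 j - _|]distrC !ger0_norm ?subr_ge0 ?mS // ?lerD2r ?mS // ltnW.
  have [j0|j_gt0] := posnP j.
    exists 1%N; split; [by []|by left; rewrite j0|].
    by move=> k ke kj; rewrite j0 in above *; apply: above => //; rewrite lt0n -j0.
  have [ej|j1e] := leqP e j.+1.
    exists j.-1; split; [by rewrite prednK // ltnW|by right; rewrite prednK|].
    move=> k ke kj; apply: below; rewrite ltn_neqAle kj -ltnS (leq_trans ke) //.
  have [le|le] := leP `|m0 j - m0 j.-1| `|m0 j - m0 j.+1|.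
    exists j.-1; split; [by rewrite prednK // ltnW|by right; rewrite prednK|].
    move=> k ke kj; have [kj'|jk|/eqP] := ltngtP k j; last by rewrite (negbTE kj).
      exact: below.
    by apply: (le_trans le); apply: above.
  exists j.+1; split; [by []|by left|].
  move=> k ke kj; have [kj'|jk|/eqP] := ltngtP k j; last by rewrite (negbTE kj).
    by apply: (le_trans (ltW le)); apply: below.
  exact: above.
set D := `|m0 j - m0 j'| in nearest; exists D; split=> //.
  rewrite normr_ge0 /=; have := mB j je; have := mB j' j'e.
  by rewrite !ler_norml => /andP[? ?] /andP[? ?]; apply/andP; split; lra.
move=> l m delta lS lm lB dm; have d0 := delta_ge0 m delta dm.
have s0 := critical_value_sign lS lm je.
have s1 := critical_value_sign lS lm j'e.
have D0 : 0 <= D by rewrite normr_ge0.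
have le1 := critical_increment lm dm (dm j je).
have le2 : `|(poly_of_roots e.+1 l).[m0 j] - (poly_of_roots e.+1 l).[m j']| <=
    e.+1%:R * (D + delta) * \prod_(k < e) (`|m0 j - m0 k| + (D + delta + delta)).
  apply: (critical_increment lm dm).
  by have := ler_distD (m0 j') (m0 j) (m j'); have := dm j' j'e; rewrite -/D; lra.
rewrite !prod_spread // in le1 le2.
have dd : delta + delta = 2 * delta by ring.
have Ddd : D + delta + delta = D + 2 * delta by ring.
rewrite dd in le1; rewrite Ddd in le2.
set E := D + 2 * delta in le2 *.
set S := spread e m0 j E in le2 *; have S0 : 0 <= S by rewrite spread_ge0 // /E; lra.
have bound u v : 0 <= u <= E -> 0 <= v <= E -> forall s, 0 <= s <= S ->
    e.+1%:R * u * (v * s) <= e.+1%:R * E ^+ 2 * S.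
  move=> /andP[u0 uE] /andP[v0 vE] s /andP[s0' sS].
  rewrite -!mulrA ler_wpM2l // mulrA [leRHS]mulrA.
  by apply: ler_pM => //; [exact: mulr_ge0 | exact: ler_pM].
have S' : 0 <= spread e m0 j (2 * delta) <= S.
  rewrite spread_ge0 ?mulr_ge0 //=; apply: ler_prod => k _.
  by rewrite /E addr_ge0 ?mulr_ge0 //=; lra.
have le1' := le_trans le1 (bound delta (2 * delta) _ _ _ S').
have le2' := le_trans le2 (bound (D + delta) E _ _ S _).
have {le1'} : `|(poly_of_roots e.+1 l).[m0 j] - (poly_of_roots e.+1 l).[m j]| <= e.+1%:R * E ^+ 2 * S.
  by apply: le1'; rewrite /E; lra.
have {le2'} : `|(poly_of_roots e.+1 l).[m0 j] - (poly_of_roots e.+1 l).[m j']| <= e.+1%:R * E ^+ 2 * S.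
  by apply: le2'; rewrite ?S0 ?lexx /E; lra.
have sgn : (-1) ^+ (e - j) = - (-1) ^+ (e - j') :> R.
  case: j'P => E'; first by rewrite E' -(subnSK je) exprS mulN1r.
  by rewrite E' -(subnSK j'e) exprS mulN1r opprK.
move: s0 s1; rewrite sgn !ler_norml -signr_odd.
by case: odd; rewrite ?expr0 ?expr1 => ? ? /andP[? ?] /andP[? ?]; apply/andP; split; lra.
Qed.

Lemma norm_le_between (R : realDomainType) (a b x B : R) :
  a <= x <= b -> `|a| <= B -> `|b| <= B -> `|x| <= B.
Proof.
by rewrite !ler_norml => /andP[? ?] /andP[? ?] /andP[? ?]; apply/andP; split; lra.
Qed.

(** * Critical values of a one-parameter family *)

(** A quantitative form of Glaeser's inequality |phi'|^2 <= C phi sup|phi''| for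
    nonnegative phi, with the scales made explicit. The bound A D^2 on the
    interval of length cD controls the coefficients of the Taylor polynomial,
    hence the second order terms by A t^2. Then phi may only be negative by
    O(A t^2), and testing this at both points c y and - c y bounds the slope:
    it is at most (phi 0 + O(A y^2)) / (c y) = O(A y) for every y from rho to D.
    The last estimate is used with y = max(rho, |t|). *)
Lemma increment_of_lower_bound (R : realFieldType) (N : nat) (c C0 : R) :
  0 < c <= 1 -> 0 <= C0 ->
  exists2 C : R, 0 <= C & forall (phi : R -> R) (g : {poly R}) (A D rho : R),
    0 <= A -> 0 <= rho <= D -> (size g <= N)%N ->
    (forall t : R, `|t| <= c * D -> `|phi t - g.[t]| <= C0 * A * t ^+ 2) ->
    (forall t : R, `|t| <= c * D -> `|phi t| <= C0 * A * D ^+ 2) ->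
    (forall t : R, `|t| <= c * D -> - (C0 * A * t ^+ 2) <= phi t) ->
    phi 0 <= C0 * A * rho ^+ 2 ->
    forall t : R, `|t| <= c * D -> `|phi t - phi 0| <= C * A * (rho * `|t| + `|t| ^+ 2).
Proof.
move=> /andP[c0 c1] C00; have [C1 C10 coefB] := coef_bound_of_sup R N.
pose C6 := C0 + N%:R * (C1 * (2 * C0)) / c ^+ 2.
have C60 : 0 <= C6.
  by rewrite addr_ge0 // divr_ge0 ?exprn_ge0 ?(ltW c0) // !mulr_ge0.
exists (C6 + (2 * C0 + C6) / c) => [|phi g A D rho A0 /andP[rho0 rhoD] sg gphi phiB phi_lo phi00 t tD].
  by rewrite addr_ge0 // divr_ge0 ?(ltW c0) // addr_ge0 // mulr_ge0.
have [->|t0] := eqVneq t 0.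
  by rewrite subrr normr0 mulr0 expr0n addr0 mulr0.
have t_gt0 : 0 < `|t| by rewrite normr_gt0.
have D_gt0 : 0 < D by rewrite -(pmulr_rgt0 _ c0) (lt_le_trans t_gt0).
have cD0 : 0 < c * D by rewrite mulr_gt0.
have cDD : c * D <= D by rewrite ger_pMl.
have CA0 : 0 <= C0 * A by rewrite mulr_ge0.
have sqr_le (x : R) : `|x| <= c * D -> x ^+ 2 <= D ^+ 2.
  move=> xD; rewrite -(ger0_norm (sqr_ge0 x)) normrX lerXn2r ?nnegrE ?(ltW D_gt0) //.
  exact: le_trans cDD.
have gB x : `|x| <= c * D -> `|g.[x]| <= 2 * C0 * A * D ^+ 2.
  move=> xD; have := gphi x xD; have := phiB x xD; rewrite distrC => a b.
  have := ler_distD (phi x) g.[x] 0; rewrite !subr0.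
  have := ler_wpM2l CA0 (sqr_le x xD); lra.
have gk := coefB g (c * D) _ sg cD0 gB.
have phi0E : phi 0 = g`_0.
  have /gphi : `|0 : R| <= c * D by rewrite normr0 ltW.
  rewrite expr0n mulr0 normr_le0 subr_eq0 => /eqP->.
  by rewrite horner_coef0.
have rest x : `|x| <= c * D -> `|phi x - phi 0 - g`_1 * x| <= C6 * A * x ^+ 2.
  move=> xD; have sg2 : (size g <= N.+2)%N by rewrite (leq_trans sg) // -addn2 leq_addr.
  have gE : g.[x] = g`_0 + (g`_1 * x + \sum_(i < N) g`_i.+2 * x ^+ i.+2).
    by rewrite (horner_coef_wide _ sg2) !big_ord_recl expr0 mulr1 expr1.
  have sumB : `|\sum_(i < N) g`_i.+2 * x ^+ i.+2| <=
      N%:R * (C1 * (2 * C0 * A * D ^+ 2) * (x / (c * D)) ^+ 2).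
    apply: (le_trans (ler_norm_sum _ _ _)).
    rewrite mulr_natl -[X in _ *+ X](card_ord N) -sumr_const; apply: ler_sum => i _.
    rewrite (@le_trans _ _ (`|g`_i.+2| * (c * D) ^+ i.+2 * (x / (c * D)) ^+ 2)) //; last first.
      by rewrite ler_wpM2r ?sqr_ge0.
    have E : (c * D) ^+ i.+2 * (x / (c * D)) ^+ 2 = (c * D) ^+ i * x ^+ 2.
      by rewrite -addn2 exprD -mulrA -exprMn [c * D * (x / _)]mulrC divfK ?gt_eqF.
    rewrite -mulrA E normrM ler_wpM2l // normrX -addn2 exprD real_normK ?num_real //.
    by rewrite ler_wpM2r ?sqr_ge0 // lerXn2r ?nnegrE ?(ltW cD0).
  have -> : phi x - phi 0 - g`_1 * x = (phi x - g.[x]) + \sum_(i < N) g`_i.+2 * x ^+ i.+2.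
    by rewrite phi0E gE; ring.
  apply: (le_trans (ler_normD _ _)).
  apply: (le_trans (lerD (gphi x xD) sumB)).
  rewrite le_eqVlt; apply/orP; left; apply/eqP; rewrite /C6.
  by field; rewrite ?gt_eqF.
pose y := Num.max rho `|t|.
have y0 : 0 < y by rewrite lt_max t_gt0 orbT.
have yD : y <= D by rewrite ge_max rhoD (le_trans tD).
have rhoy : rho <= y by rewrite le_max lexx.
have ty : y <= rho + `|t| by rewrite ge_max lerDl normr_ge0 lerDr.
have cy : `|c * y| <= c * D by rewrite ger0_norm ?(ltW (mulr_gt0 c0 y0)) // ler_pM2l.
have cy' : `|- (c * y)| <= c * D by rewrite normrN.
have slope : `|g`_1| * c <= (2 * C0 + C6) * A * y.
  have := rest _ cy; have := rest _ cy'; have := phi_lo _ cy; have := phi_lo _ cy'.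
  rewrite !ler_norml sqrrN => a b /andP[_ a'] /andP[_ b'].
  have phi0y : phi 0 <= C0 * A * y ^+ 2.
    by rewrite (le_trans phi00) // ler_wpM2l // lerXn2r ?nnegrE // ltW.
  have c2 : (c * y) ^+ 2 <= c * y * y.
    by rewrite expr2 ler_wpM2l ?mulr_ge0 ?(ltW c0) ?(ltW y0) // ger_pMl.
  have c3 : c * y * y <= y ^+ 2 by rewrite expr2 -mulrA ger_pMl // mulr_gt0.
  have K0 : 0 <= (C0 + C6) * A by rewrite mulr_ge0 // addr_ge0.
  have h1 := ler_wpM2l K0 (le_trans c2 c3).
  rewrite -(ler_pM2r y0).
  have -> : `|g`_1| * c * y = `|g`_1 * (c * y)|.
    by rewrite normrM (ger0_norm (ltW (mulr_gt0 c0 y0))) mulrA.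
  rewrite ler_norml; clear -h1 phi0y a b a' b'.
  by apply/andP; split; lra.
have := rest t tD.
rewrite real_normK ?num_real // => rt.
have := ler_distD (phi 0 + g`_1 * t) (phi t) (phi 0).
have -> : phi t - (phi 0 + g`_1 * t) = phi t - phi 0 - g`_1 * t by ring.
rewrite [phi 0 + _]addrC addrK normrM => tri.
apply: (le_trans tri).
have g1 : `|g`_1| <= (2 * C0 + C6) / c * A * y.
  by rewrite -(ler_pM2r c0) (le_trans slope) // le_eqVlt; apply/orP; left; apply/eqP; field; rewrite gt_eqF.
have K1 : 0 <= (2 * C0 + C6) / c * A.
  by rewrite mulr_ge0 // divr_ge0 ?(ltW c0) // addr_ge0 // mulr_ge0.
have h2 := ler_wpM2r (normr_ge0 t) (le_trans g1 (ler_wpM2l K1 ty)).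
have t2 : t ^+ 2 = `|t| * `|t| by rewrite -expr2 real_normK ?num_real.
have h3 : 0 <= C6 * A * (rho * `|t|) by rewrite !mulr_ge0.
rewrite t2 in rt *; set u := `|t| in h2 h3 rt *.
have -> : (C6 + (2 * C0 + C6) / c) * A * (rho * u + u * u) =
  C6 * A * (u * u) + C6 * A * (rho * u) + (2 * C0 + C6) / c * A * (rho + u) * u by ring.
lra.
Qed.

Lemma spread_le_prod (R : numDomainType) e (m : nat -> R) j (x a : R) (eta : nat -> R) :
  1 <= a -> 0 <= x -> (forall k, (k < e)%N -> 0 <= eta k) ->
  (forall k, (k < e)%N -> `|m j - m k| + x <= a * eta k) ->
  spread e m j x <= a ^+ e * \prod_(k < e | (k : nat) != j) eta k.
Proof.
move=> a1 x0 eta0 me.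
apply: (@le_trans _ _ (a ^+ #|[pred k : 'I_e | (k : nat) != j]| * \prod_(k < e | (k : nat) != j) eta k)).
  rewrite -prodr_const -big_split /=; apply: ler_prod => k _.
  by rewrite addr_ge0 //= me.
apply: ler_wpM2r; first by apply: prodr_ge0 => k _; apply: eta0.
by rewrite ler_weXn2l // (leq_trans (max_card _)) // card_ord.
Qed.

(** The key estimate. Fix a critical point mu = m 0 j of the polynomial at time 0
    and follow the value of the polynomial at mu as time varies. With D the
    distance from mu to the nearest other critical point, two regimes occur.
    For |t| <= c D increment_of_lower_bound applies, with A = spread e (m 0) j 0
    and rho the smaller of D and the distance from mu to the root l 0 i, so the
    increment is O(A (rho |t| + t^2)).
    For larger |t| the critical points near mu have merged at the scale |t|, and
    the two-sided bound of the critical value is enough. The numbers eta k stand for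
    distances |z - m 0 k| from a point z that is closer to mu than to any other
    critical point; the conclusion is thus an increment O(|t| |P'(z)|). *)
Lemma critical_value_increment (R : rcfType) N e (B L M tau0 : R) :
  (e < N)%N -> 1 <= B -> 1 <= L -> 0 <= M -> 0 < tau0 <= 1 ->
  exists2 C : R, 0 <= C & forall (l m : R -> nat -> R),
    (forall t : R, `|t| <= tau0 ->
       [/\ nondecreasing_upto e.+1 (l t), interlacing_critical e (l t) (m t),
           forall i, (i < e.+1)%N -> `|l t i| <= B &
           forall k, (k < e)%N -> `|m 0 k - m t k| <= L * `|t|]) ->
    (forall z : R, `|z| <= B -> exists2 g : {poly R}, (size g <= N)%N &
       forall t : R, `|t| <= tau0 ->
         `|(poly_of_roots e.+1 (l t)).[z] - g.[t]| <= M * `|t| ^+ N) ->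
    forall (eta : nat -> R) j i (t : R), (j < e)%N -> (i < e.+1)%N -> `|t| <= tau0 ->
      (forall k, (k < e)%N -> `|t| <= eta k) ->
      (forall k, (k < e)%N -> `|m 0 j - m 0 k| <= 2 * eta k) ->
      `|m 0 j - l 0 i| <= 2 * eta j ->
      `|(poly_of_roots e.+1 (l t)).[m 0 j] - (poly_of_roots e.+1 (l 0)).[m 0 j]| <=
        C * `|t| * \prod_(k < e) eta k.
Proof.
move=> eN B1 L1 M0 /andP[tau_gt0 tau1].
have B_gt0 : 0 < B by rewrite (lt_le_trans ltr01).
have L_gt0 : 0 < L by rewrite (lt_le_trans ltr01).
have L0 := ltW L_gt0.
have [c cE] : exists x : R, x = tau0 / (2 * B * L) by eexists.
have BL : 1 <= 2 * B * L.
  by apply: mulr_ege1 => //; apply: mulr_ege1 => //; rewrite ler1n.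
have BL0 : 0 < 2 * B * L by rewrite (lt_le_trans ltr01).
have c0 : 0 < c by rewrite cE divr_gt0.
have c1 : c <= 1 by rewrite cE ler_pdivrMr // mul1r (le_trans tau1).
have cBL : c * (2 * B * L) = tau0 by rewrite cE divfK // gt_eqF.
have [C0 C0E] : exists x : R, x = e.+1%:R * 4 ^+ e * (9 + 2 * L ^+ 2) + M by eexists.
have L2 : 0 <= L ^+ 2 by rewrite sqr_ge0.
have C00 : 0 <= C0.
  by rewrite C0E addr_ge0 // !mulr_ge0 ?exprn_ge0 // addr_ge0 // mulr_ge0.
have [|C2 C20 incr] := @increment_of_lower_bound R N c C0 _ C00; first by rewrite c0.
have [q qE] : exists x : R, x = c^-1 + 2 * L by eexists.
have q0 : 0 < q by rewrite qE addr_gt0 ?invr_gt0 // mulr_gt0.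
have [C3 C3E] : exists x : R, x = e.+1%:R * q ^+ 2 * (2 + q) ^+ e by eexists.
have C30 : 0 <= C3.
  have q2 : 0 <= 2 + q by rewrite addr_ge0 // ltW.
  by rewrite C3E mulr_ge0 ?exprn_ge0 // mulr_ge0 ?sqr_ge0.
exists (3 * 2 ^+ e * C2 + 2 * C3) => [|l m lm taylor eta j i t je ie ttau teta meta leta].
  by rewrite addr_ge0 ?mulr_ge0 ?exprn_ge0.
have zero_tau : `|0 : R| <= tau0 by rewrite normr0 ltW.
have [lS0 lm0 lB0 _] := lm 0 zero_tau.
have mle k : (k < e)%N -> l 0 k <= m 0 k <= l 0 k.+1 by case: lm0 => + _; apply.
have mB k : (k < e)%N -> `|m 0 k| <= B.
  by move=> ke; apply: norm_le_between (mle k ke) (lB0 k (ltnW ke)) (lB0 k.+1 ke).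
have mS : nondecreasing_upto e (m 0).
  move=> a b; rewrite leq_eqVlt => /orP[/eqP->//|ab] be.
  have /andP[_ h1] := mle a (ltn_trans ab be); have /andP[h2 _] := mle b be.
  apply: (le_trans h1); apply: le_trans h2; apply: lS0 => //; exact: ltnW.
have [D [/andP[D0 DB] Dm valB]] := critical_value_bound mS mB je.
set mu := m 0 j in meta leta valB *.
have eta0 k : (k < e)%N -> 0 <= eta k by move=> /teta; apply: le_trans.
set E := \prod_(k < e | (k : nat) != j) eta k.
have E0 : 0 <= E by apply: prodr_ge0 => k _; apply: eta0.
have prodE : \prod_(k < e) eta k = eta j * E by rewrite (bigD1 (Ordinal je)).
have etaj0 := eta0 j je; have tj := teta j je.
have at_tau (x : R) : `|x| <= tau0 -> `|(poly_of_roots e.+1 (l x)).[mu]| <=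
    e.+1%:R * (D + 2 * (L * `|x|)) ^+ 2 * spread e (m 0) j (D + 2 * (L * `|x|)).
  by move=> xt; have [a b c' d] := lm x xt; exact: valB a b c' d.
set A := spread e (m 0) j 0.
have A0 : 0 <= A by apply: spread_ge0.
have [tD|tD] := leP `|t| (c * D); last first.
  (* |t| > c D: both values are bounded at the scale |t|. *)
  have Dt : D <= c^-1 * `|t| by rewrite -(ler_pM2l c0) mulVKf ?gt_eqF // ltW.
  have coarse (x : R) : `|x| <= `|t| ->
      `|(poly_of_roots e.+1 (l x)).[mu]| <= C3 * `|t| * (eta j * E).
    move=> xt; apply: (le_trans (at_tau x (le_trans xt ttau))).
    have x0 : 0 <= `|x| by [].
    set y := D + 2 * (L * `|x|).
    have y0 : 0 <= y by rewrite addr_ge0 ?mulr_ge0 ?(ltW L_gt0).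
    have yq : y <= q * `|t|.
      have Lxt : L * `|x| <= L * `|t| by rewrite ler_pM2l.
      by rewrite /y qE; clear -Dt Lxt; lra.
    have SE : spread e (m 0) j y <= (2 + q) ^+ e * E.
      apply: spread_le_prod => // [|k ke]; first by clear -q0; lra.
      have mk := meta k ke; have qk := ler_wpM2l (ltW q0) (teta k ke).
      by rewrite -/mu; clear -mk qk yq; lra.
    have y2 : y ^+ 2 <= q ^+ 2 * (`|t| * eta j).
      rewrite (@le_trans _ _ ((q * `|t|) ^+ 2)) ?lerXn2r ?nnegrE ?mulr_ge0 ?(ltW q0) //.
      by rewrite exprMn ler_wpM2l ?sqr_ge0 // expr2 ler_wpM2l.
    rewrite -mulrA; apply: (le_trans (ler_wpM2l _ (ler_pM _ _ y2 SE))) => //.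
    - exact: sqr_ge0.
    - exact: spread_ge0.
    by rewrite le_eqVlt; apply/orP; left; apply/eqP; rewrite C3E; ring.
  apply: (le_trans (ler_normB _ _)); rewrite prodE.
  have h1 := coarse t (lexx _); have h2 : `|0 : R| <= `|t| by rewrite normr0.
  have {}h2 := coarse 0 h2.
  apply: (le_trans (lerD h1 h2)).
  have rest0 : 0 <= 3 * 2 ^+ e * C2 * `|t| * (eta j * E) by rewrite !mulr_ge0 // ?exprn_ge0 //.
  by clear -rest0; lra.
pose sg : R := (-1) ^+ (e - j).
have sgN (x : R) : `|sg * x| = `|x|.
  by rewrite normrM normrX normrN1 expr1n mul1r.
pose phi (x : R) := sg * (poly_of_roots e.+1 (l x)).[mu].
have [g sizeg gB] := taylor mu (mB j je).
pose rho : R := Num.min `|mu - l 0 i| D.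
have cDtau : c * D <= tau0.
  by rewrite -cBL ler_pM2l // (le_trans DB) // ler_peMr // mulr_ge0 // ltW.
have LcD (x : R) : `|x| <= c * D -> L * `|x| <= D.
  move=> xD; apply: (@le_trans _ _ (L * (c * D))); first by rewrite ler_pM2l.
  rewrite mulrA ler_piMl //; apply: (@le_trans _ _ tau0) => //.
  rewrite -cBL [c * _]mulrC ler_pM2r // ler_peMl //.
  by clear -B1; lra.
have cDD : c * D <= D by rewrite ler_piMl.
have spread_small (x : R) : 0 <= x <= 3 * D -> spread e (m 0) j x <= 4 ^+ e * A.
  move=> /andP[x0 xD]; have -> : 4 = 1 + 3 :> R by ring.
  by apply: (@spread_le_exp _ _ _ _ _ _ D).
have C0A (X : R) : 0 <= X -> e.+1%:R * 9 * (4 ^+ e * A) * X <= C0 * A * X.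
  move=> X0; rewrite ler_wpM2r //.
  have -> : C0 * A = e.+1%:R * 9 * (4 ^+ e * A) + (e.+1%:R * 4 ^+ e * (2 * L ^+ 2) + M) * A.
    by rewrite C0E; ring.
  by rewrite lerDl mulr_ge0 // addr_ge0 // !mulr_ge0 // ?exprn_ge0 //.
have phiB (x : R) : `|x| <= c * D -> `|phi x| <= C0 * A * D ^+ 2.
  move=> xD; rewrite sgN; apply: (le_trans (at_tau x (le_trans xD cDtau))).
  have Lx := LcD x xD; have Lx0 : 0 <= L * `|x| by rewrite mulr_ge0 ?(ltW L_gt0).
  have y3 : 0 <= D + 2 * (L * `|x|) <= 3 * D by clear -Lx Lx0 D0; apply/andP; split; lra.
  have /andP[y0 y3'] := y3.
  have sq3 : (D + 2 * (L * `|x|)) ^+ 2 <= (3 * D) ^+ 2.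
    by rewrite lerXn2r // nnegrE ?mulr_ge0.
  rewrite -mulrA; apply: (le_trans (ler_wpM2l (ler0n _ _) (ler_pM _ _ sq3 _))).
  - exact: sqr_ge0.
  - exact: spread_ge0.
  - exact: spread_small y3.
  apply: le_trans (C0A (D ^+ 2) (sqr_ge0 _)).
  by rewrite le_eqVlt; apply/orP; left; apply/eqP; ring.
have phi_lo (x : R) : `|x| <= c * D -> - (C0 * A * x ^+ 2) <= phi x.
  move=> xD; have [lS lmx lB dm] := lm x (le_trans xD cDtau).
  apply: le_trans (critical_value_lower lS lmx dm je); rewrite lerN2.
  have Lx := LcD x xD; have Lx0 : 0 <= L * `|x| by rewrite mulr_ge0 ?(ltW L_gt0).
  have s4 : spread e (m 0) j (2 * (L * `|x|)) <= 4 ^+ e * A.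
    by apply: spread_small; clear -Lx Lx0; apply/andP; split; lra.
  rewrite (@le_trans _ _ (e.+1%:R * (L * `|x|) * (2 * (L * `|x|)) * (4 ^+ e * A))) //.
    by rewrite ler_wpM2l // !mulr_ge0 // (ltW L_gt0).
  have -> : e.+1%:R * (L * `|x|) * (2 * (L * `|x|)) * (4 ^+ e * A) =
     e.+1%:R * (4 ^+ e * (2 * L ^+ 2 * (A * `|x| ^+ 2))) by ring.
  rewrite real_normK ?num_real //.
  have -> : C0 * A * x ^+ 2 = e.+1%:R * (4 ^+ e * (2 * L ^+ 2 * (A * x ^+ 2))) +
     (e.+1%:R * 4 ^+ e * 9 + M) * (A * x ^+ 2) by rewrite C0E; ring.
  rewrite lerDl; apply: mulr_ge0; last by rewrite mulr_ge0 ?sqr_ge0.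
  by rewrite addr_ge0 // !mulr_ge0 ?exprn_ge0.
have rhoD : 0 <= rho <= D.
  by rewrite le_min normr_ge0 D0 /= ge_min lexx orbT.
have phi00 : phi 0 <= C0 * A * rho ^+ 2.
  rewrite /rho; have [muD|] := leP `|mu - l 0 i| D; last first.
    move=> _; apply: (le_trans (ler_norm _)); apply: phiB.
    by rewrite normr0 mulr_ge0 // ltW.
  apply: (le_trans (ler_norm _)); rewrite sgN.
  have d0 k : (k < e)%N -> `|m 0 k - m 0 k| <= 0 by rewrite subrr normr0.
  have := critical_increment lm0 d0 (lexx `|mu - l 0 i|).
  have -> : (poly_of_roots e.+1 (l 0)).[l 0 i] = 0.
    by rewrite horner_poly_of_roots (bigD1 (Ordinal ie)) //= subrr mul0r.
  rewrite subr0 addr0 prod_spread //; set r := `|mu - l 0 i| in muD * => h.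
  have r0 : 0 <= r by rewrite normr_ge0.
  apply: (le_trans h); apply: le_trans (C0A (r ^+ 2) (sqr_ge0 _)).
  have := spread_small r; rewrite r0 /= => /(_ _) s4.
  have {}s4 : spread e (m 0) j r <= 4 ^+ e * A by apply: s4; clear -muD r0; lra.
  rewrite -!mulrA ler_wpM2l //.
  have -> : 9 * (4 ^+ e * (A * r ^+ 2)) = r * (r * (4 ^+ e * A)) + 8 * (4 ^+ e * A * (r * r)) by ring.
  have s5 : r * (r * spread e (m 0) j r) <= r * (r * (4 ^+ e * A)) by rewrite !ler_wpM2l.
  have s6 : 0 <= 8 * (4 ^+ e * A * (r * r)) by rewrite !mulr_ge0 // ?exprn_ge0 //.
  by clear -s5 s6; lra.
have gphi (x : R) : `|x| <= c * D -> `|phi x - (sg *: g).[x]| <= C0 * A * x ^+ 2.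
  move=> xD; rewrite hornerZ /phi -mulrBr sgN.
  apply: (le_trans (gB x (le_trans xD cDtau))).
  (* The Taylor remainder is harmless because |x| <= 1 and |x| <= D, and A is a product of
     e - 1 <= N - 2 factors that are all at least D. *)
  have xA : `|x| ^+ N <= A * x ^+ 2.
    have N2 : N = (N - 2 + 2)%N by rewrite subnK // (leq_trans _ eN) // ltnS (leq_trans _ je).
    rewrite N2 exprD real_normK ?num_real // ler_wpM2r ?sqr_ge0 //.
    apply: (@le_trans _ _ (`|x| ^+ e.-1)).
      apply: ler_wiXn2l => //; first by rewrite (le_trans xD) // (le_trans cDtau).
      by rewrite -subn1 -subSS leq_sub2r.
    apply: (le_trans _ (exp_le_spread je D0 Dm)).
    by rewrite lerXn2r ?nnegrE // (le_trans xD).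
  apply: (le_trans (ler_wpM2l M0 xA)).
  have -> : C0 * A * x ^+ 2 = M * (A * x ^+ 2) +
     (e.+1%:R * 4 ^+ e * (9 + 2 * L ^+ 2)) * (A * x ^+ 2) by rewrite C0E; ring.
  rewrite lerDl; apply: mulr_ge0; last by rewrite mulr_ge0 ?sqr_ge0.
  by rewrite !mulr_ge0 ?exprn_ge0 // addr_ge0 // mulr_ge0.
have sgsize : (size (sg *: g) <= N)%N by rewrite (leq_trans (size_scale_leq _ _)).
have := incr phi _ A D rho A0 rhoD sgsize gphi phiB phi_lo phi00 t tD.
rewrite /phi -mulrBr sgN => h; apply: (le_trans h).
have rho2 : rho <= 2 * eta j by rewrite ge_min leta.
have AE : A <= 2 ^+ e * E.
  apply: spread_le_prod => // [|k ke]; first by rewrite ler1n.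
  by rewrite addr0 meta.
have h1 : rho * `|t| + `|t| ^+ 2 <= 3 * eta j * `|t|.
  have r1 := ler_wpM2r (normr_ge0 t) rho2; have r2 := ler_wpM2r (normr_ge0 t) tj.
  by rewrite expr2; clear -r1 r2; lra.
have rt0 : 0 <= rho * `|t| + `|t| ^+ 2.
  by case/andP: rhoD => r0 _; rewrite addr_ge0 ?mulr_ge0 ?sqr_ge0.
rewrite prodE -mulrA.
apply: (le_trans (ler_wpM2l C20 (ler_pM A0 rt0 AE h1))).
have -> : C2 * (2 ^+ e * E * (3 * eta j * `|t|)) = 3 * 2 ^+ e * C2 * `|t| * (eta j * E) by ring.
have rest0 : 0 <= 2 * C3 * `|t| * (eta j * E) by rewrite !mulr_ge0.
by clear -rest0; lra.
Qed.

(** * Lipschitz roots of one-parameter families *)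
Lemma normr_prodB_le (R : numDomainType) e (a b c : nat -> R) (delta theta : R) :
  0 <= delta -> 0 <= theta ->
  (forall k, (k < e)%N -> [/\ `|a k - b k| <= delta, `|a k| <= c k, `|b k| <= c k & theta <= c k]) ->
  theta * `|\prod_(k < e) a k - \prod_(k < e) b k| <= e%:R * delta * \prod_(k < e) c k.
Proof.
move=> d0 th0; elim: e => [|e IH] abc.
  by rewrite !big_ord0 subrr normr0 !mulr0 !mul0r.
have [ab ac bc tc] := abc e (leqnn _).
have c0 : 0 <= c e by apply: le_trans tc.
have abc' k : (k < e)%N -> [/\ `|a k - b k| <= delta, `|a k| <= c k, `|b k| <= c k & theta <= c k].
  by move/ltnW/abc.
rewrite !big_ord_recr /=; set A := \prod_(k < e) a k; set B := \prod_(k < e) b k.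
set C := \prod_(k < e) c k.
have -> : A * a e - B * b e = A * (a e - b e) + (A - B) * b e by rewrite mulrBr mulrBl addrA subrK.
have AC : `|A| <= C.
  by rewrite normr_prod; apply: ler_prod => k _; rewrite normr_ge0; have [] := abc' k (ltn_ord k).
rewrite (le_trans (ler_wpM2l th0 (ler_normD _ _))) // mulrDr !normrM.
have -> : e.+1%:R * delta * (C * c e) = c e * (C * delta) + e%:R * delta * C * c e.
  by rewrite -natr1; ring.
apply: lerD; last by rewrite mulrA ler_pM ?mulr_ge0 // IH.
by rewrite ler_pM ?mulr_ge0 // ler_pM.
Qed.

Lemma deriv_poly_of_roots_le (R : numDomainType) d (l : nat -> R) (z theta : R) : 0 <= theta ->
  (forall k, (k < d)%N -> theta <= `|z - l k|) ->
  theta * `|(poly_of_roots d l)^`().[z]| <= d%:R * `|(poly_of_roots d l).[z]|.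
Proof.
move=> th0; elim: d => [|d IH] zl.
  by rewrite /poly_of_roots big_ord0 derivC horner0 normr0 mulr0 mul0r.
have {}IH := IH (fun k kd => zl k (ltnW kd)).
rewrite /poly_of_roots big_ord_recr /= -/(poly_of_roots d l) derivM derivXsubC mulr1.
rewrite hornerD !hornerM hornerXsubC.
rewrite (le_trans (ler_wpM2l th0 (ler_normD _ _))) // mulrDr -natr1 mulrDl mul1r !normrM.
apply: lerD; first by rewrite !mulrA ler_wpM2r.
by rewrite mulrC ler_wpM2l // zl.
Qed.

(** One step of the induction on the degree: Lipschitz critical points imply that
    the roots increase at most linearly. Put z = l 0 i + K |t|. If the critical
    point m 0 i is closer to l 0 i than 2 K |t|, it bounds l t i. Otherwise z is at
    distance at least K |t| from all roots and critical points, so that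
    K |t| |Q(z)| <= |P(z)| at time 0, where (e+1) Q = P'. On the other hand, P(z)
    changes by at most C |t| |Q(z)|: compare with the critical point m 0 j nearest
    to z, where critical_value_increment applies, and integrate the increment of
    P' between the two. For K > C the sign of P(z) is unchanged, and this sign
    forces l t i <= z. *)
Lemma root_increment_upper (R : rcfType) N e (B L M tau0 : R) :
  (0 < e < N)%N -> 1 <= B -> 1 <= L -> 0 <= M -> 0 < tau0 <= 1 ->
  exists2 C : R, 0 <= C & forall (l m : R -> nat -> R),
    (forall t : R, `|t| <= tau0 ->
       [/\ nondecreasing_upto e.+1 (l t), interlacing_critical e (l t) (m t),
           forall i, (i < e.+1)%N -> `|l t i| <= B &
           forall k, (k < e)%N -> `|m 0 k - m t k| <= L * `|t|]) ->
    (forall z : R, `|z| <= B -> exists2 g : {poly R}, (size g <= N)%N &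
       forall t : R, `|t| <= tau0 ->
         `|(poly_of_roots e.+1 (l t)).[z] - g.[t]| <= M * `|t| ^+ N) ->
    forall i (t : R), (i < e.+1)%N -> `|t| <= tau0 -> l t i <= l 0 i + C * `|t|.
Proof.
move=> /andP[e0 eN] B1 L1 M0 tauP.
have [C1 C10 valincr] := critical_value_increment eN B1 L1 M0 tauP.
have L0 : 0 <= L by rewrite (le_trans ler01).
pose C2 := e.+1%:R * e%:R * L * 3 ^+ e.
have C20 : 0 <= C2 by rewrite !mulr_ge0 ?exprn_ge0.
have [K [K1 LK CK]] : exists K : R, [/\ 1 <= K, L <= K & C1 + C2 < K].
  by exists (C1 + C2 + L + 1); split; lra.
have K0 : 0 <= K by rewrite (le_trans ler01).
exists (2 * K + L) => [|l m lm taylor i t ie tt]; first by rewrite addr_ge0 // mulr_ge0.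
have [->|t0] := eqVneq t 0; first by rewrite normr0 mulr0 addr0.
have t_gt0 : 0 < `|t| by rewrite normr_gt0.
have zero_tau : `|0 : R| <= tau0 by rewrite normr0; case/andP: tauP => /ltW.
have [lS0 lm0 lB0 _] := lm 0 zero_tau; have [lSt lmt lBt dm] := lm t tt.
have mle0 k : (k < e)%N -> l 0 k <= m 0 k <= l 0 k.+1 by case: lm0 => + _; apply.
have mlet k : (k < e)%N -> l t k <= m t k <= l t k.+1 by case: lmt => + _; apply.
set lam := l 0 i; pose theta := K * `|t|.
have th_gt0 : 0 < theta by rewrite mulr_gt0 // (lt_le_trans ltr01).
have Lth : L * `|t| <= theta by rewrite ler_wpM2r.
have tth : `|t| <= theta by rewrite ler_peMl.
have [/andP[ie' mclose]|mfar] := boolP ((i < e)%N && (m 0 i <= lam + 2 * theta)).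
  have /andP[lmi _] := mlet i ie'; apply: (le_trans lmi).
  have := dm i ie'; rewrite distrC ler_norml => /andP[_ h].
  by move: mclose h; rewrite /theta; clear; lra.
have {}mfar : (i < e)%N -> lam + 2 * theta < m 0 i.
  by move=> ie'; move: mfar; rewrite ie' /= -ltNge.
pose z := lam + theta.
have mS k k' : (k <= k')%N -> (k' < e)%N -> m 0 k <= m 0 k'.
  rewrite leq_eqVlt => /orP[/eqP->//|kk'] k'e.
  have /andP[_ h1] := mle0 k (ltn_trans kk' k'e); have /andP[h2 _] := mle0 k' k'e.
  by apply: (le_trans h1); apply: le_trans h2; apply: lS0 => //; exact: ltnW.
have below k : (k < i)%N -> m 0 k <= lam.
  move=> ki; have ke : (k < e)%N by rewrite (leq_trans ki).
  by have /andP[_ h] := mle0 k ke; apply: (le_trans h); apply: lS0.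
have above k : (i <= k)%N -> (k < e)%N -> z + theta < m 0 k.
  move=> ik ke; have ie' := leq_ltn_trans ik ke.
  by have h := mfar ie'; have h' := mS _ _ ik ke; rewrite /z; clear -h h'; lra.
pose eta k := `|z - m 0 k|.
have etaB k : (k < i)%N -> eta k = z - m 0 k.
  by move=> /below h; rewrite /eta ger0_norm // /z; clear -h th_gt0; lra.
have etaA k : (i <= k)%N -> (k < e)%N -> eta k = m 0 k - z.
  by move=> ik ke; have := above k ik ke; rewrite /eta => h; rewrite ltr0_norm; clear -h th_gt0; lra.
have eta_th k : (k < e)%N -> theta <= eta k.
  move=> ke; have [ik|ki] := leqP i k.
    by rewrite etaA //; have h := above k ik ke; clear -h; lra.
  by rewrite etaB //; have h := below k ki; rewrite /z; clear -h; lra.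
have [j [je nearest jlam]] : exists j, [/\ (j < e)%N,
    forall k, (k < e)%N -> eta j <= eta k & `|m 0 j - lam| <= 2 * eta j].
  have candB : (0 < i)%N -> [/\ (i.-1 < e)%N, forall k, (k < i)%N -> eta i.-1 <= eta k
      & `|m 0 i.-1 - lam| <= 2 * eta i.-1].
    move=> i0; have i1 : (i.-1 < i)%N by rewrite prednK.
    have i1e : (i.-1 < e)%N by rewrite prednK.
    split=> // [k ki|].
      rewrite !etaB // lerD2l lerN2 mS // -ltnS prednK //.
    by have := below _ i1; rewrite etaB // => h; rewrite ler0_norm /z; clear -h th_gt0; lra.
  have candA : (i < e)%N -> (forall k, (i <= k)%N -> (k < e)%N -> eta i <= eta k)
      /\ `|m 0 i - lam| <= 2 * eta i.
    move=> ie'; split=> [k ik ke|].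
      by rewrite !etaA // lerD2r mS.
    by have := above _ (leqnn i) ie'; rewrite etaA // => h; rewrite ger0_norm; move: h; rewrite /z; clear -th_gt0; lra.
  have [i0|i_gt0] := posnP i.
    have ie' : (i < e)%N by rewrite i0.
    have [nA cA] := candA ie'; exists i; split=> // k ke; apply: nA => //.
    by rewrite i0.
  have [i1e nB cB] := candB i_gt0.
  have [ei|ie'] := leqP e i.
    by exists i.-1; split=> // k ke; apply: nB; rewrite (leq_trans ke).
  have [nA cA] := candA ie'.
  have [le|le] := leP (eta i.-1) (eta i).
    exists i.-1; split=> // k ke; have [ik|ki] := leqP i k; last exact: nB.
    by apply: (le_trans le); apply: nA.
  exists i; split=> // k ke; have [ik|ki] := leqP i k; first exact: nA.
  by apply: (le_trans (ltW le)); apply: nB.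
set E := \prod_(k < e) eta k.
have eta_gt0 k : (k < e)%N -> 0 < eta k by move=> /eta_th; apply: lt_le_trans.
have E_gt0 : 0 < E by apply: prodr_gt0 => k _; apply: eta_gt0.
pose Pt := poly_of_roots e.+1 (l t); pose P0 := poly_of_roots e.+1 (l 0).
have valmu : `|(Pt - P0).[m 0 j]| <= C1 * `|t| * E.
  rewrite hornerD hornerN; apply: (valincr l m lm taylor eta j i t) => //.
    by move=> k ke; apply: le_trans (eta_th k ke).
  move=> k ke; have := ler_distD z (m 0 j) (m 0 k); have := nearest k ke.
  by rewrite [ `|m 0 j - z|]distrC -/(eta j) -/(eta k); clear; lra.
have valz : `|(Pt - P0).[z] - (Pt - P0).[m 0 j]| <= C2 * `|t| * E.
  pose H := C2 * `|t| * E / eta j.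
  have -> : C2 * `|t| * E = H * eta j by rewrite divfK // gt_eqF ?eta_gt0.
  apply: horner_increment => w wz _; rewrite -/(eta j) in wz.
  have -> : (Pt - P0)^`().[w] = e.+1%:R * (\prod_(k < e) (w - m t k) - \prod_(k < e) (w - m 0 k)).
    case: lmt lm0 => _ dPt [_ dP0].
    by rewrite derivB dPt dP0 -scalerBr hornerZ hornerD hornerN !horner_poly_of_roots.
  rewrite normrM normr_nat /H ler_pdivlMr ?eta_gt0 //.
  have := @normr_prodB_le _ e (fun k => w - m t k) (fun k => w - m 0 k) (fun k => 3 * eta k)
    (L * `|t|) (eta j) (mulr_ge0 L0 (normr_ge0 _)) (ltW (eta_gt0 j je)).
  have -> : \prod_(k < e) (3 * eta k) = 3 ^+ e * E.
    by rewrite big_split /= prodr_const card_ord.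
  move=> h; rewrite [leLHS]mulrAC -[leLHS]mulrA.
  apply: (le_trans (ler_wpM2l (ler0n _ _) (h _))); last first.
    by rewrite le_eqVlt; apply/orP; left; apply/eqP; rewrite /C2; ring.
  move=> k ke; have nk := nearest k ke; have tk := eta_th k ke; have dk := dm k ke.
  have wk : `|w - m 0 k| <= 2 * eta k.
    by have := ler_distD z w (m 0 k); rewrite -/(eta k); clear -wz nk; lra.
  have ek := eta_gt0 k ke.
  split; last by clear -nk ek; lra.
  - by have -> : w - m t k - (w - m 0 k) = m 0 k - m t k by ring.
  - by have := ler_distD (m 0 k) w (m t k); clear -wk dk Lth tk; lra.
  - by clear -wk ek; lra.
have dz : `|Pt.[z] - P0.[z]| <= (C1 + C2) * `|t| * E.
  have := ler_distD (Pt - P0).[m 0 j] (Pt - P0).[z] 0; rewrite !subr0 !hornerD !hornerN in valmu valz *.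
  by clear -valmu valz; lra.
have P0z : theta * E <= `|P0.[z]|.
  have : theta * `|P0^`().[z]| <= e.+1%:R * `|P0.[z]|.
    apply: deriv_poly_of_roots_le => [|k ke]; first exact: ltW.
    have [ki|ik] := leqP k i.
      by have : l 0 k <= lam := lS0 _ _ ki ie; rewrite /z => h; rewrite ger0_norm; clear -h th_gt0; lra.
    have ie' : (i < e)%N by apply: leq_trans ik _.
    have := mfar ie'; have /andP[_ h] := mle0 i ie'; have := lS0 _ _ ik ke.
    by rewrite /z => h1 h2; rewrite ler0_norm; clear -h h1 h2 th_gt0; lra.
  case: lm0 => _ ->; rewrite hornerZ normrM normr_nat horner_poly_of_roots normr_prod -/E.
  by rewrite mulrCA ler_pM2l // ltr0n.
have lt : `|Pt.[z] - P0.[z]| < `|P0.[z]|.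
  apply: (le_lt_trans dz); apply: lt_le_trans P0z.
  by rewrite ltr_pM2r // /theta ltr_pM2r.
have [|zl] := leP (l t i) z.
  by rewrite /z /theta => h; apply: (le_trans h); rewrite lerD2l ler_wpM2r //; clear -K0 L0; lra.
exfalso; move: lt; apply/negP; rewrite -leNgt.
have sPt : 0 <= (-1) ^+ (e.+1 - i) * Pt.[z].
  apply: poly_of_roots_sign => [|k ki|k /andP[ik ke]]; first exact: ltnW.
    have ke : (k < e)%N by rewrite (leq_trans ki).
    have /andP[h _] := mlet k ke; apply: (le_trans h).
    have := dm k ke; rewrite distrC ler_norml => /andP[_ h'].
    by have := below k ki; rewrite /z; clear -h' Lth; lra.
  by apply: (le_trans (ltW zl)); apply: lSt.
have sP0 : 0 <= (-1) ^+ (e.+1 - i.+1) * P0.[z].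
  apply: poly_of_roots_sign => [//|k ki|k /andP[ik ke]].
    by have : l 0 k <= lam := lS0 k i ki ie; rewrite /z; clear -th_gt0; lra.
  have ie' : (i < e)%N by apply: leq_trans ik _.
  have := mfar ie'; have /andP[_ h] := mle0 i ie'; have := lS0 _ _ ik ke.
  by rewrite /z; clear -h th_gt0; lra.
move: sPt sP0; rewrite -(subnSK ie) exprS mulN1r mulNr oppr_ge0 -signr_odd.
set a := Pt.[z]; set b := P0.[z].
by case: odd; rewrite ?expr0 ?expr1 ?mul1r ?mulN1r ?oppr_le0 ?oppr_ge0 => ha hb;
  [rewrite (ler0_norm hb) ger0_norm | rewrite (ger0_norm hb) ler0_norm]; clear -ha hb; lra.
Qed.

(** Near every point f is a polynomial of degree less than N, up to an error of
    order N with a uniform constant. All the regularity that is needed of the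
    coefficients is of this form. *)
Definition taylor_bounded (R : numDomainType) N (M T : R) (f : R -> R) :=
  forall t0 : R, `|t0| <= T -> exists2 g : {poly R}, (size g <= N)%N &
    forall t : R, `|t| <= T -> `|f t - g.[t - t0]| <= M * `|t - t0| ^+ N.

Lemma taylor_bounded_scale (R : numDomainType) N (M T c : R) (f h : R -> R) :
  0 <= M -> `|c| <= 1 -> (forall t, `|t| <= T -> h t = c * f t) ->
  taylor_bounded N M T f -> taylor_bounded N M T h.
Proof.
move=> M0 c1 hE fT t0 t0T; have [g sg gf] := fT t0 t0T.
exists (c *: g) => [|t tT]; first by rewrite (leq_trans (size_scale_leq _ _)).
rewrite hE // hornerZ -mulrBr normrM.
have h0 : 0 <= M * `|t - t0| ^+ N by rewrite mulr_ge0 ?exprn_ge0.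
by rewrite -[X in _ <= X]mul1r ler_pM // gf.
Qed.

Lemma taylor_bounded_horner (R : numDomainType) N n (M T B z : R) (F : R -> {poly R}) :
  0 <= M -> 1 <= B -> `|z| <= B -> (forall t, (size (F t) <= n)%N) ->
  (forall k, taylor_bounded N M T (fun t => (F t)`_k)) ->
  taylor_bounded N (n%:R * (M * B ^+ n)) T (fun t => (F t).[z]).
Proof.
move=> M0 B1 zB sF FT t0 t0T.
have ex k : exists g : {poly R}, (size g <= N)%N /\
    forall t, `|t| <= T -> `|(F t)`_k - g.[t - t0]| <= M * `|t - t0| ^+ N.
  by have [g sg gF] := FT k t0 t0T; exists g.
have [g gP] := choice ex.
exists (\sum_(k < n) z ^+ k *: g k) => [|t tT].
  apply: (leq_trans (size_sum _ _ _)); apply/bigmax_leqP => k _.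
  by apply: (leq_trans (size_scale_leq _ _)); have [] := gP k.
rewrite (horner_coef_wide _ (sF t)) horner_sum -sumrB.
apply: (le_trans (ler_norm_sum _ _ _)); rewrite -mulrA mulr_natl.
rewrite -[X in _ *+ X](card_ord n) -sumr_const; apply: ler_sum => k _.
rewrite hornerZ [_ * z ^+ k]mulrC -mulrBr normrM mulrC mulrAC.
have [_ gk] := gP k.
apply: ler_pM => //; first exact: gk.
rewrite normrX (@le_trans _ _ (B ^+ k)) ?lerXn2r ?nnegrE ?(le_trans ler01 B1) //.
by rewrite ler_weXn2l // ltnW.
Qed.

(** Induction on the degree, through the polynomial P'/(e+1), whose coefficients
    are those of P multiplied by numbers in [0, 1]; the induction hypothesis is
    used on the intermediate interval of half-length s + tau = (s + T)/2, so that
    two-sided neighbourhoods of the points of [-s, s] are available. The upper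
    bound at both base points t and t' gives the absolute value. *)
Theorem lipschitz_roots (R : rcfType) N d (B M s T : R) :
  (d < N)%N -> 1 <= B -> 0 <= M -> 0 < s < T -> T <= 1 ->
  exists2 L : R, 1 <= L & forall l : R -> nat -> R,
    (forall t : R, `|t| <= T ->
       nondecreasing_upto d (l t) /\ forall i, (i < d)%N -> `|l t i| <= B) ->
    (forall k, taylor_bounded N M T (fun t => (poly_of_roots d (l t))`_k)) ->
    forall i (t t' : R), (i < d)%N -> `|t| <= s -> `|t'| <= s ->
      `|l t i - l t' i| <= L * `|t - t'|.
Proof.
move=> dN B1 M0 + T1; elim: d dN s => [|e IH] eN s /andP[s0 sT]; first by exists 1.
have B0 : 0 <= B by rewrite (le_trans ler01).
have [tau tau_gt0 tauE] : exists2 tau : R, 0 < tau & 2 * tau = T - s.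
  by exists ((T - s) / 2); [rewrite divr_gt0 // subr_gt0 | field].
suff [C C0 Cinc] : exists2 C : R, 0 <= C & forall l : R -> nat -> R,
    (forall t : R, `|t| <= T ->
       nondecreasing_upto e.+1 (l t) /\ forall i, (i < e.+1)%N -> `|l t i| <= B) ->
    (forall k, taylor_bounded N M T (fun t => (poly_of_roots e.+1 (l t))`_k)) ->
    forall i (t x : R), (i < e.+1)%N -> `|t| <= s -> `|x| <= tau ->
      l (t + x) i <= l t i + C * `|x|.
  exists (1 + C + 2 * B / tau) => [|l lP lT i t t' ie ts t's].
    by rewrite -addrA lerDl addr_ge0 // divr_ge0 ?mulr_ge0 ?(ltW tau_gt0).
  have sB (u : R) : `|u| <= s -> `|l u i| <= B.
    by move=> us; have [|_ ->//] := lP u; lra.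
  have q0 : 0 <= 2 * B / tau by rewrite divr_ge0 ?mulr_ge0 // ltW.
  have [le|gt] := leP `|t - t'| tau; last first.
    apply: (le_trans (ler_normB _ _)).
    have : 2 * B <= 2 * B / tau * `|t - t'|.
      by rewrite -mulrA ler_peMr ?mulr_ge0 // mulrC ler_pdivlMr // mul1r ltW.
    have : 0 <= (1 + C) * `|t - t'| by rewrite mulr_ge0 // addr_ge0.
    by have := sB t ts; have := sB t' t's; lra.
  have h1 := Cinc l lP lT i t' (t - t') ie t's le.
  have le' : `|t' - t| <= tau by rewrite distrC.
  have h2 := Cinc l lP lT i t (t' - t) ie ts le'.
  rewrite [t' + _]addrC subrK in h1; rewrite [t + _]addrC subrK distrC in h2.
  have : 0 <= (1 + 2 * B / tau) * `|t - t'| by rewrite mulr_ge0 // addr_ge0.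
  by rewrite ler_norml => h3; apply/andP; split; lra.
(* Degree one has no critical point; the coefficient - l t 0 itself, shifted by
   B to be nonnegative, is handled by the same lemma as the critical values. *)
have [e0|e_gt0] := posnP e.
  rewrite {IH}e0 in eN *.
  have cP : 0 < tau <= 1 by rewrite tau_gt0 /=; lra.
  have C00 : 0 <= 2 * B + M by rewrite addr_ge0 // mulr_ge0.
  have [C C0 incr] := increment_of_lower_bound N cP C00.
  exists (2 * C) => [|l lP lT i t x]; first by rewrite mulr_ge0.
  rewrite ltnS leqn0 => /eqP-> ts xtau.
  have coefE u : (poly_of_roots 1 (l u))`_0 = - l u 0%N.
    by rewrite /poly_of_roots big_ord1 coefB coefX coefC add0r.
  have [|g sg gP] := lT 0%N t; first lra.
  have inT (y : R) : `|y| <= tau -> `|t + y| <= T.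
    by move=> yt; have := ler_normD t y; lra.
  have lB (y : R) : `|y| <= tau -> `|l (t + y) 0%N| <= B.
    by move=> /inT/lP[_ ->].
  pose phi (y : R) := B - l (t + y) 0%N.
  have phiB (y : R) : `|y| <= tau -> 0 <= phi y <= 2 * B.
    by move=> /lB; rewrite ler_norml /phi => /andP[? ?]; apply/andP; split; lra.
  have CC0 (y : R) : 0 <= (2 * B + M) * 1 * y ^+ 2 by rewrite mulr1 mulr_ge0 ?sqr_ge0.
  have ler11 : 0 <= (1 : R) <= (1 : R) by rewrite ler01 /=.
  have sgB : (size (g + B%:P)%R <= N)%N.
    rewrite (leq_trans (size_polyD _ _)) // geq_max sg (leq_trans (size_polyC_leq1 _)) //.
    by rewrite (leq_trans _ eN).
  have := incr phi (g + B%:P) 1 1 1 ler01 ler11 sgB _ _ _ _ x.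
  rewrite mulr1 => /(_ _ _ _ _ xtau) h.
  have {h} : `|phi x - phi 0| <= C * 1 * (1 * `|x| + `|x| ^+ 2).
    apply: h => [y yt|y yt|y yt|].
    - have := gP (t + y) (inT y yt); rewrite coefE [t + y]addrC addrK [y + t]addrC.
      have -> : phi y - (g + B%:P).[y] = - l (t + y) 0%N - g.[y].
        by rewrite /phi hornerD hornerC; ring.
      move=> h; apply: (le_trans h).
      have yN : `|y| ^+ N <= y ^+ 2.
        rewrite -(real_normK (num_real y)); apply: ler_wiXn2l => //; lra.
      have := ler_wpM2l M0 yN.
      have : 0 <= 2 * B * y ^+ 2 by rewrite mulr_ge0 ?sqr_ge0 // mulr_ge0.
      by rewrite mulr1; lra.
    - have /andP[p0 pB] := phiB y yt; rewrite ger0_norm // expr1n; lra.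
    - have /andP[p0 _] := phiB y yt; apply: le_trans p0; rewrite oppr_le0; exact: CC0.
    - have z0 : `|0 : R| <= tau by rewrite normr0 ltW.
      by have /andP[_ pB] := phiB 0 z0; rewrite expr1n; clear -pB M0; lra.
  rewrite mulr1 mul1r /phi addr0 => h.
  have x2 : `|x| ^+ 2 <= `|x| by rewrite expr2 ler_piMl //; lra.
  have := ler_wpM2l C0 x2.
  by move: h; rewrite ler_norml => /andP[h _] h'; lra.
have [|L L1 QL] := IH (ltnW eN) (s + tau); first by apply/andP; split; lra.
pose M' := e.+2%:R * (M * B ^+ e.+2).
have M'0 : 0 <= M' by rewrite /M' mulr_ge0 // mulr_ge0 // exprn_ge0.
have tauP : 0 < tau <= 1 by rewrite tau_gt0 /=; lra.
have eN' : (0 < e < N)%N by rewrite e_gt0 ltnW.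
have [C C0 up] := root_increment_upper eN' B1 L1 M'0 tauP.
exists C => // l lP lT i t x ie ts xtau.
have ex u : exists m : nat -> R, `|u| <= T -> interlacing_critical e (l u) m.
  have [uT|_] := boolP (`|u| <= T); last by exists (fun=> 0).
  by have [lS _] := lP u uT; have [m mP] := critical_points lS; exists m.
have [m mP] := choice ex.
have mLip k (u v : R) : (k < e)%N -> `|u| <= s + tau -> `|v| <= s + tau ->
    `|m u k - m v k| <= L * `|u - v|.
  apply: QL => [w wT|j].
    have [lS lB] := lP w wT; have [lm _] := mP w wT; split=> [a b ab be|a ae].
      move: ab; rewrite leq_eqVlt => /orP[/eqP->//|ab].
      have /andP[_ h1] := lm a (ltn_trans ab be); have /andP[h2 _] := lm b be.
      by apply: (le_trans h1); apply: le_trans h2; apply: lS => //; exact: ltnW.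
    exact: norm_le_between (lm a ae) (lB a (ltnW ae)) (lB a.+1 ae).
  pose c : R := if (j <= e)%N then j.+1%:R / e.+1%:R else 0.
  have e1 : 0 < e.+1%:R :> R by rewrite ltr0n.
  apply: (@taylor_bounded_scale _ _ _ _ c _ _ M0 _ _ (lT j.+1)).
    rewrite /c; case: leqP => je; last by rewrite normr0.
    by rewrite normrM normfV !normr_nat ler_pdivrMr // mul1r ler_nat.
  move=> w wT; have [_ dP] := mP w wT.
  have -> : poly_of_roots e (m w) = e.+1%:R^-1 *: (poly_of_roots e.+1 (l w))^`().
    by rewrite dP scalerA mulVf ?scale1r // gt_eqF.
  rewrite coefZ coef_deriv /c -mulr_natr; case: leqP => je; first by ring.
  by rewrite nth_default ?size_poly_of_roots //; ring.
have := up (fun y => l (t + y)) (fun y => m (t + y)) _ _ i x ie xtau.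
rewrite addr0; apply => [y yt|z zB].
  have tyT : `|t + y| <= T by have := ler_normD t y; lra.
  have [lS lB] := lP _ tyT; split => // [|k ke]; first exact: mP.
  have yE : `|y| = `|t - (t + y)| by rewrite opprD addrA subrr add0r normrN.
  have tys : `|t + y| <= s + tau by have := ler_normD t y; clear -ts yt; lra.
  by rewrite ?addr0 yE; apply: mLip => //; clear -ts tau_gt0; lra.
have szF (u : R) : (size (poly_of_roots e.+1 (l u)) <= e.+2)%N by rewrite size_poly_of_roots.
have Tz : taylor_bounded N M' T (fun u => (poly_of_roots e.+1 (l u)).[z]).
  exact: taylor_bounded_horner M0 B1 zB szF lT.
have tT : `|t| <= T by clear -ts sT; lra.
have [g sg gP] := Tz t tT.
exists g => // y yt; have tyT : `|t + y| <= T by have := ler_normD t y; clear -ts yt tauE tau_gt0; lra.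
by have := gP _ tyT; rewrite [t + y]addrC addrK.
Qed.

(** * Power series along lines *)
#[local] Existing Instance totally_filter.

Section unconditional_sums.
Variables (R : realType) (I : choiceType).
Implicit Types (u : I -> R) (J : {fset I}).

Lemma partial_sumE u J : partial_sum u J = \sum_(i <- J) u i.
Proof. by rewrite [RHS]big_seq_fsetE. Qed.

Lemma cvg_totallyP u (l : R) : (partial_sum u @ totally --> l) <->
  (forall e : R, 0 < e -> exists J0, forall J, (J0 `<=` J)%fset -> `|l - \sum_(i <- J) u i| < e).
Proof.
split=> [/cvgrPdist_lt cu e /cu[J0 _ sJ]|cu].
  by exists J0 => J J0J; rewrite -partial_sumE; apply: sJ.
apply/cvgrPdist_lt => e /cu[J0 J0P]; exists J0 => // J /J0P.
by rewrite -partial_sumE.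
Qed.

(** Finite sums that avoid a suitable finite set J0 are at most 2 in absolute
    value; apply this to the nonnegative and to the negative terms separately. *)
Lemma bounded_abs_partial_sum u (l : R) : partial_sum u @ totally --> l ->
  exists M, forall J, \sum_(i <- J) `|u i| <= M.
Proof.
move=> /cvg_totallyP/(_ 1 ltr01)[J0 J0P].
have far (K : {fset I}) : (forall i, i \in K -> i \notin J0) -> `|\sum_(i <- K) u i| <= 2.
  move=> KJ0; have a := J0P _ (fsubsetUl J0 K); have b := J0P _ (fsubset_refl J0).
  have E : \sum_(i <- (J0 `|` K)%fset) u i = \sum_(i <- J0) u i + \sum_(i <- K) u i.
    rewrite (big_fsetID _ (mem J0)) /=; congr (_ + _); apply: eq_fbigl => i; rewrite !inE /=.
      by case: (i \in J0); rewrite ?andbF.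
    by have := KJ0 i; case: (i \in K) => [/(_ isT)->|_]; case: (i \in J0).
  rewrite E in a; set s0 := \sum_(i <- J0) u i in a b; set s := \sum_(i <- K) u i in a *.
  by move: a b; rewrite !ltr_norml ler_norml => /andP[? ?] /andP[? ?]; apply/andP; split; lra.
exists (\sum_(i <- J0) `|u i| + 4) => J; rewrite (big_fsetID _ (mem J0)) /=; apply: lerD.
  rewrite [leRHS](big_fsetID _ (mem J)) /=.
  rewrite [X in X + _](_ : _ = \sum_(i <- [fset x in J | x \in J0]%fset) `|u i|).
    by rewrite lerDl sumr_ge0.
  by apply: eq_fbigl => i; rewrite !inE /= andbC.
set K := [fset x in J | x \notin J0]%fset.
have KJ0 i : i \in K -> i \notin J0 by rewrite !inE => /andP[].
rewrite (big_fsetID _ (fun i => 0 <= u i)) /=.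
rewrite [X in X + _](_ : _ = \sum_(i <- [fset x in K | 0 <= u x]%fset) u i); last first.
  by apply: eq_fbigr => i; rewrite !inE /= => /andP[_ ui] _; rewrite ger0_norm.
rewrite [X in _ + X](_ : _ = - \sum_(i <- [fset x in K | ~~ (0 <= u x)]%fset) u i); last first.
  rewrite -sumrN; apply: eq_fbigr => i; rewrite !inE /= -ltNge => /andP[_ ui] _.
  by rewrite ltr0_norm.
have -> : 4 = 2 + 2 :> R by ring.
have farK (P : pred I) : `|\sum_(i <- [fset x in K | P x]%fset) u i| <= 2.
  by apply: far => i; rewrite !inE /= => /andP[/andP[]].
apply: lerD; first exact: le_trans (ler_norm _) (farK _).
by rewrite lerNl; have := farK (fun x => ~~ (0 <= u x)); rewrite ler_norml => /andP[].
Qed.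

(** For nonnegative terms the limit is the supremum of the finite sums; in
    general u = (|u| + u) - |u|. *)
Lemma cvg_of_bounded_abs u (M : R) : (forall J, \sum_(i <- J) `|u i| <= M) ->
  exists l : R, partial_sum u @ totally --> l.
Proof.
have nonneg (v : I -> R) (M' : R) : (forall i, 0 <= v i) -> (forall J, \sum_(i <- J) v i <= M') ->
    exists l : R, partial_sum v @ totally --> l.
  move=> v0 vM; pose E := [set \sum_(i <- J) v i | J in [set: {fset I}]]%classic.
  have supE : has_sup E.
    split; first by exists (\sum_(i <- fset0) v i); exists fset0.
    by exists M' => _ [J _ <-]; apply: vM.
  exists (sup E); apply/cvg_totallyP => e e0.
  have [_ [J0 _ <-] lt] := sup_adherent e0 supE; exists J0 => J J0J.
  have le1 : \sum_(i <- J) v i <= sup E by apply: sup_upper_bound => //; exists J.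
  have le2 : \sum_(i <- J0) v i <= \sum_(i <- J) v i.
    rewrite [leRHS](big_fsetID _ (mem J0)) /=.
    rewrite [X in _ <= X + _](_ : _ = \sum_(i <- J0) v i) ?lerDl ?sumr_ge0 //.
    apply: eq_fbigl => i; rewrite !inE /= andbC.
    by case: (boolP (i \in J0)) => // /(fsubsetP J0J)->.
  by rewrite ger0_norm ?subr_ge0 //; lra.
move=> uM.
have [a aP] := nonneg (fun i => `|u i|) M (fun i => normr_ge0 _) uM.
have [||b bP] := nonneg (fun i => `|u i| + u i) (2 * M).
- by move=> i; rewrite addrC -lerBlDr sub0r lerNnormlW.
- move=> J; have -> : 2 * M = M + M by ring.
  rewrite big_split /=; apply: lerD => //; apply: le_trans (uM J).
  by apply: ler_sum => i _; apply: ler_norm.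
exists (b - a); have -> : partial_sum u =
    fun J => partial_sum (fun i => `|u i| + u i) J - partial_sum (fun i => `|u i|) J.
  apply/funext => J; rewrite !partial_sumE -sumrB.
  by apply: eq_bigr => i _; rewrite addrC addrA addNr add0r.
exact: cvgB.
Qed.

End unconditional_sums.

(** Majorants in the sense of Cauchy: the monomial (w + h v)^alpha, as a polynomial
    in h, is dominated by (tau + h)^|alpha| when |w i| <= tau and |v i| <= 1. *)
Definition coef_dominated (R : numDomainType) (p q : {poly R}) := forall k, `|p`_k| <= q`_k.

Lemma coef_dominatedM (R : numDomainType) (p q p' q' : {poly R}) :
  coef_dominated p q -> coef_dominated p' q' -> coef_dominated (p * p') (q * q').
Proof.
move=> pq pq' k; rewrite !coefM (le_trans (ler_norm_sum _ _ _)) //.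
by apply: ler_sum => i _; rewrite normrM ler_pM.
Qed.

Lemma coef_dominated1 (R : numDomainType) : @coef_dominated R 1 1.
Proof. by move=> k; rewrite coef1 normr_nat. Qed.

Lemma coef_dominatedX (R : numDomainType) (p q : {poly R}) m :
  coef_dominated p q -> coef_dominated (p ^+ m) (q ^+ m).
Proof.
move=> pq; elim: m => [|m IH]; first exact: coef_dominated1.
by rewrite !exprS; apply: coef_dominatedM.
Qed.

Lemma coef_dominated_prod (R : numDomainType) (I : finType) (p q : I -> {poly R}) :
  (forall i, coef_dominated (p i) (q i)) -> coef_dominated (\prod_i p i) (\prod_i q i).
Proof.
move=> pq; apply: (big_ind2 (@coef_dominated R)) => //; first exact: coef_dominated1.
by move=> ? ? ? ?; apply: coef_dominatedM.
Qed.

Lemma coef_dominated_coef (R : numDomainType) (p q : {poly R}) (tau : R) k : 0 <= tau ->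
  coef_dominated p q -> `|p`_k| * tau ^+ k <= q.[tau].
Proof.
move=> t0 pq; have q0 j : 0 <= q`_j by apply: le_trans (pq j).
have kn : (k < size q + k.+1)%N by rewrite addnS ltnS leq_addl.
rewrite (@horner_coef_wide _ (size q + k.+1)) ?leq_addr // (bigD1 (Ordinal kn)) //=.
rewrite (le_trans (ler_wpM2r _ (pq k))) ?exprn_ge0 // lerDl.
by apply: sumr_ge0 => i _; rewrite mulr_ge0 ?exprn_ge0.
Qed.

Lemma coef_dominated_taylor (R : numFieldType) (p q : {poly R}) (tau h : R) N :
  0 < tau -> `|h| <= tau -> coef_dominated p q ->
  `|p.[h] - \sum_(k < N) p`_k * h ^+ k| <= q.[tau] * (`|h| / tau) ^+ N.
Proof.
move=> t0 ht pq; pose n := (size p + size q + N)%N.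
have q0 j : 0 <= q`_j by apply: le_trans (pq j).
have ht0 : 0 <= `|h| / tau by rewrite divr_ge0 // ltW.
have -> : \sum_(k < N) p`_k * h ^+ k = \sum_(k < n) (if (k < N)%N then p`_k * h ^+ k else 0).
  rewrite -big_mkcond /= (big_ord_widen n (fun k => p`_k * h ^+ k)) //.
  by rewrite /n leq_addl.
rewrite (@horner_coef_wide _ n p) /n -?addnA ?leq_addr // -/n -sumrB.
rewrite (@horner_coef_wide _ n q) /n -?addnA; last by rewrite addnCA leq_addr.
rewrite mulr_suml (le_trans (ler_norm_sum _ _ _)) //; apply: ler_sum => k _.
case: ltnP => [_|Nk]; first by rewrite subrr normr0 !mulr_ge0 ?exprn_ge0 // ltW.
rewrite subr0 normrM normrX -mulrA ler_pM ?exprn_ge0 //.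
have -> : `|h| = tau * (`|h| / tau) by rewrite mulrC divfK // gt_eqF.
rewrite exprMn [tau * _ / tau]mulrAC divff ?mul1r ?gt_eqF //.
rewrite ler_wpM2l ?exprn_ge0 ?(ltW t0) // ler_wiXn2l //.
by rewrite ler_pdivrMr // mul1r.
Qed.

Section power_series.
Variables (R : realType) (n : nat) (f : 'rV[R]_n -> R) (x0 : 'rV[R]_n).
Variables (c : {ffun 'I_n -> nat} -> R) (rho M : R).
Hypothesis rho_gt0 : 0 < rho.
Hypothesis f_sum : forall x : 'rV[R]_n, (forall i, `|x 0 i - x0 0 i| <= rho) ->
  partial_sum (fun alpha => c alpha * multimonomial alpha (x - x0)) @ totally --> f x.
Hypothesis abs_sum : forall J : {fset {ffun 'I_n -> nat}},
  \sum_(alpha <- J) `|c alpha| * rho ^+ (\sum_i alpha i) <= M.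

Lemma power_series_bounded (x : 'rV[R]_n) :
  (forall i, `|x 0 i - x0 0 i| <= rho) -> `|f x| <= M.
Proof.
move=> xr; apply: (cvgr_to_le (cvg_norm (f_sum xr))).
apply: nearW => J; rewrite partial_sumE.
apply: (le_trans (ler_norm_sum _ _ _)); apply: le_trans (abs_sum J).
apply: ler_sum => alpha _; rewrite normrM ler_wpM2l // normr_prod -prodrXr.
apply: ler_prod => i _; rewrite normr_ge0 /= normrX lerXn2r ?nnegrE ?(ltW rho_gt0) //.
by rewrite !mxE xr.
Qed.

(** The coefficients of the Taylor polynomial are infinite sums over alpha. They
    converge since they are dominated by the coefficients of the sum of
    |c alpha| (tau + h)^|alpha|, which is bounded at h = tau because 2 tau = rho;
    the same majorant bounds the remainder of every partial sum. *)
Lemma power_series_line_taylor N (w v : 'rV[R]_n) :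
  (forall i, `|w 0 i| <= rho / 2) -> (forall i, `|v 0 i| <= 1) ->
  exists2 g : {poly R}, (size g <= N)%N & forall h : R, `|h| <= rho / 2 ->
    `|f (x0 + (w + h *: v)) - g.[h]| <= M * (`|h| / (rho / 2)) ^+ N.
Proof.
move=> wr v1; set tau := rho / 2.
have tau_gt0 : 0 < tau by rewrite divr_gt0.
have tau2 : tau + tau = rho by rewrite /tau; field.
pose p (alpha : {ffun 'I_n -> nat}) : {poly R} :=
  \prod_i ((w 0 i)%:P + (v 0 i)%:P * 'X) ^+ alpha i.
pose q (alpha : {ffun 'I_n -> nat}) : {poly R} := \prod_i (tau%:P + 'X) ^+ alpha i.
have pE alpha h : (p alpha).[h] = multimonomial alpha (w + h *: v).
  rewrite horner_prod; apply: eq_bigr => i _.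
  by rewrite horner_exp hornerD hornerM !hornerC hornerX !mxE [h * _]mulrC.
have qE alpha : (q alpha).[tau] = rho ^+ (\sum_i alpha i).
  rewrite horner_prod -prodrXr; apply: eq_bigr => i _.
  by rewrite horner_exp hornerD hornerC hornerX tau2.
have pq alpha : coef_dominated (p alpha) (q alpha).
  apply: coef_dominated_prod => i; apply: coef_dominatedX => k.
  rewrite !coefD !coefC coefMX coefC coefX.
  by case: k => [|[|k]] /=; rewrite ?addr0 ?add0r ?normr0.
have ex k : exists l : R, partial_sum (fun alpha => c alpha * (p alpha)`_k) @ totally --> l.
  apply: (@cvg_of_bounded_abs _ _ _ (M / tau ^+ k)) => J.
  rewrite ler_pdivlMr ?exprn_gt0 // mulr_suml; apply: le_trans (abs_sum J).
  apply: ler_sum => alpha _; rewrite normrM -mulrA ler_wpM2l // -qE.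
  by apply: coef_dominated_coef => //; exact: ltW.
have [G GP] := choice ex.
exists (\poly_(k < N) G k) => [|h hr]; first exact: size_poly.
have in_ball i : `|(x0 + (w + h *: v)) 0 i - x0 0 i| <= rho.
  rewrite !mxE addrC addKr -tau2 (le_trans (ler_normD _ _)) // lerD ?wr //.
  by rewrite normrM -[leRHS]mulr1 ler_pM // v1.
pose u k alpha := c alpha * (p alpha)`_k.
have lim : (partial_sum (fun alpha => c alpha * multimonomial alpha (x0 + (w + h *: v) - x0)) J
    - \sum_(k < N) partial_sum (u k) J * h ^+ k) @[J --> totally] -->
    f (x0 + (w + h *: v)) - \sum_(k < N) G k * h ^+ k.
  apply: cvgB; first exact: f_sum.
  apply: cvg_big => [|k _]; first exact: add_continuous.
  exact: cvgMr_tmp (GP k).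
rewrite horner_poly; apply: (cvgr_to_le (cvg_norm lim)).
apply: nearW => J; rewrite !partial_sumE.
have -> : \sum_(k < N) partial_sum (u k) J * h ^+ k =
    \sum_(alpha <- J) c alpha * \sum_(k < N) (p alpha)`_k * h ^+ k.
  under eq_bigr do rewrite partial_sumE mulr_suml.
  rewrite exchange_big /=; apply: eq_bigr => alpha _.
  by rewrite mulr_sumr; apply: eq_bigr => k _; rewrite mulrA.
rewrite -sumrB (le_trans (ler_norm_sum _ _ _)) //.
apply: (@le_trans _ _ (\sum_(alpha <- J) `|c alpha| * rho ^+ (\sum_i alpha i) * (`|h| / tau) ^+ N)).
  apply: ler_sum => alpha _; rewrite -mulrBr normrM -mulrA ler_wpM2l //.
  by rewrite -qE [_ - x0]addrC addKr -pE; apply: coef_dominated_taylor.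
by rewrite -mulr_suml ler_wpM2r ?abs_sum // exprn_ge0 // divr_ge0 // ltW.
Qed.

End power_series.

(** The Taylor bound is stated for every base point x0 + w in the half cube and
    every direction v, with one constant M: this uniformity is what allows the
    one-parameter theorem to be used on all segments near x0 at once. *)
Definition taylor_on_lines (R : realType) n (f : 'rV[R]_n -> R) (x0 : 'rV[R]_n) (rho M : R) :=
  [/\ 0 <= M,
    forall x : 'rV[R]_n, (forall i, `|x 0 i - x0 0 i| <= rho) -> `|f x| <= M &
    forall N (w v : 'rV[R]_n),
      (forall i, `|w 0 i| <= rho / 2) -> (forall i, `|v 0 i| <= 1) ->
      exists2 g : {poly R}, (size g <= N)%N & forall h : R, `|h| <= rho / 2 ->
        `|f (x0 + (w + h *: v)) - g.[h]| <= M * (`|h| / (rho / 2)) ^+ N].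

(** Convergence at the corner x0 + (rho, ..., rho) of the cube already makes the
    sums of |c_alpha| rho^|alpha| bounded, which controls the whole cube. *)
Lemma analytic_line_taylor (R : realType) n (f : 'rV[R]_n -> R) (x0 : 'rV[R]_n) :
  analytic_at f x0 -> exists2 r0 : R, 0 < r0 & forall rho : R, 0 < rho <= r0 ->
    exists M : R, taylor_on_lines f x0 rho M.
Proof.
move=> [c /nbhs_ballP[e /= e0 sumf]].
exists (e / 2) => [|rho /andP[rho0 rhoe]]; first by rewrite divr_gt0.
have f_sum (x : 'rV[R]_n) : (forall i, `|x 0 i - x0 0 i| <= rho) ->
    partial_sum (fun alpha => c alpha * multimonomial alpha (x - x0)) @ totally --> f x.
  move=> xr; apply: sumf; split => // i j; rewrite ord1 /ball /= distrC.
  by have := xr j; clear -rho0 rhoe e0; lra.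
pose x1 : 'rV[R]_n := x0 + const_mx rho.
have x1r i : `|x1 0 i - x0 0 i| <= rho by rewrite !mxE [x0 0 i + _]addrC addrK ger0_norm // ltW.
have [M absM] := bounded_abs_partial_sum (f_sum _ x1r).
have abs_sum (J : {fset {ffun 'I_n -> nat}}) :
    \sum_(alpha <- J) `|c alpha| * rho ^+ (\sum_i alpha i) <= M.
  rewrite (le_trans _ (absM J)) // le_eqVlt; apply/orP; left; apply/eqP.
  apply: eq_bigr => alpha _; rewrite normrM /multimonomial.
  rewrite normr_prod; congr (_ * _); rewrite -prodrXr; apply: eq_bigr => i _.
  by rewrite !mxE [x0 0 i + _]addrC addrK normrX ger0_norm // ltW.
exists M; split=> [|x xr|N w v wr v1].
- by apply: le_trans (abs_sum fset0); rewrite big_seq_fset0.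
- exact: power_series_bounded rho0 f_sum abs_sum x xr.
- exact: power_series_line_taylor rho0 f_sum abs_sum N w v wr v1.
Qed.

(** * Roots of an analytic family *)
Lemma coef_le_enorm (R : realType) n (v : 'rV[R]_n) i : `|v 0 i| <= enorm v.
Proof.
rewrite -sqrtr_sqr ler_wsqrtr // (bigD1 i) //= lerDl.
by apply: sumr_ge0 => j _; apply: sqr_ge0.
Qed.

Lemma enorm_sub_lt (R : realType) n (u v : 'rV[R]_n) r :
  enorm u < r -> enorm v < r -> enorm (u - v) <= 2 * r.
Proof.
move=> ur vr; have r0 : 0 < r by apply: le_lt_trans ur; exact: sqrtr_ge0.
have sq (w : 'rV[R]_n) : enorm w < r -> \sum_(i < n) w 0 i ^+ 2 <= r ^+ 2.
  move=> wr; have s0 : 0 <= \sum_(i < n) w 0 i ^+ 2 by apply: sumr_ge0 => i _; apply: sqr_ge0.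
  by rewrite -(sqr_sqrtr s0) lerXn2r ?nnegrE ?sqrtr_ge0 ?(ltW r0) // ltW.
rewrite -(ger0_norm (mulr_ge0 (ler0n R 2) (ltW r0))) -sqrtr_sqr ler_wsqrtr //.
have -> : (2 * r) ^+ 2 = 2 * (r ^+ 2 + r ^+ 2) by ring.
apply: (@le_trans _ _ (2 * (\sum_(i < n) u 0 i ^+ 2 + \sum_(i < n) v 0 i ^+ 2))).
  rewrite -big_split mulr_sumr; apply: ler_sum => i _; rewrite !mxE /=.
  set b := u 0 i; set c := v 0 i; rewrite -subr_ge0.
  have -> : 2 * (b ^+ 2 + c ^+ 2) - (b - c) ^+ 2 = (b + c) ^+ 2 by ring.
  exact: sqr_ge0.
by rewrite ler_wpM2l // lerD // sq.
Qed.

Section monic_family.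
Variables (R : realType) (n d : nat) (a : 'I_d -> 'rV[R]_n -> R).
Implicit Types x : 'rV[R]_n.

Lemma coef_monic_family x k : (monic_family a x)`_k =
  if (k < d)%N then \sum_(i < d | (d - i.+1 == k)%N) a i x else (k == d)%:R.
Proof.
rewrite coefD coefXn coef_sum.
have -> : \sum_(i < d) (a i x *: 'X^(d - i.+1))`_k = \sum_(i < d | (d - i.+1 == k)%N) a i x.
  rewrite [RHS]big_mkcond; apply: eq_bigr => i _.
  by rewrite coefZ coefXn eq_sym; case: eqP => _; rewrite ?mulr1 ?mulr0.
case: ltnP => kd; first by rewrite ltn_eqF // add0r.
by rewrite big_pred0 ?addr0 // => i; apply: ltn_eqF; apply: leq_trans kd; rewrite ltn_subrL ltn0Sn (leq_trans _ (ltn_ord i)).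
Qed.

Lemma size_monic_family x : size (monic_family a x) = d.+1.
Proof.
apply/eqP; rewrite eqn_leq; apply/andP; split; last first.
  rewrite ltnNge; apply/negP => /leq_sizeP/(_ d (leqnn d))/eqP.
  by rewrite coef_monic_family ltnn eqxx oner_eq0.
by apply/leq_sizeP => k dk; rewrite coef_monic_family ltnNge (ltnW dk) /= gtn_eqF.
Qed.

Lemma monic_family_monic x : monic_family a x \is monic.
Proof. by rewrite monicE lead_coefE size_monic_family coef_monic_family ltnn eqxx. Qed.

Lemma coef_monic_family_ord k : (k < d)%N ->
  exists j : 'I_d, forall x, (monic_family a x)`_k = a j x.
Proof.
move=> kd; have jd : (d - k.+1 < d)%N by rewrite ltn_subrL (leq_trans _ kd).
exists (Ordinal jd) => x; rewrite coef_monic_family kd (big_pred1 (Ordinal jd)) // => i.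
apply/eqP/eqP => E; last by rewrite E /= subnSK // subKn // ltnW.
by apply: val_inj; rewrite /= -E subnSK // subKn // ltnW.
Qed.

End monic_family.

Definition ordered_root (R : realType) d (Lambda : 'rV[R]_d) (k : nat) : R :=
  oapp (fun j => Lambda 0 j) 0 (insub k : option 'I_d).

Lemma ordered_root_ord (R : realType) d (Lambda : 'rV[R]_d) (j : 'I_d) :
  ordered_root Lambda j = Lambda 0 j.
Proof. by rewrite /ordered_root valK. Qed.

Lemma ordered_roots_product (R : realType) d (p : {poly R}) (Lambda : 'rV[R]_d) :
  p \is monic -> size p = d.+1 -> ordered_roots p Lambda ->
  nondecreasing_upto d (ordered_root Lambda) /\ p = poly_of_roots d (ordered_root Lambda).
Proof.
move=> pm sp [S mupP]; split=> [i j ij jd|].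
  by have := S (Ordinal (leq_ltn_trans ij jd)) (Ordinal jd) ij; rewrite -!ordered_root_ord.
apply: poly_of_rootsP => // z; rewrite -mupP -sum1_card [leqRHS]big_mkcond /=.
by apply: leq_sum => i _; rewrite ordered_root_ord inE; case: eqP.
Qed.

Theorem theorem4p1 (R : realType) (n d : nat) (Omega : set 'rV[R]_n)
    (a : 'I_d -> 'rV[R]_n -> R) (Lambda : 'rV[R]_n -> 'rV[R]_d) :
  open Omega ->
  (forall i : 'I_d, analytic_on Omega (a i)) ->
  (forall x, Omega x -> all_roots_real (monic_family a x)) ->
  (forall x, Omega x -> ordered_roots (monic_family a x) (Lambda x)) ->
  locally_lipschitz Omega Lambda.
Proof.
move=> oO aO _ LO x0 Ox0.
have ex_r i : exists r0 : R, 0 < r0 /\ forall rho : R, 0 < rho <= r0 ->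
    exists M : R, taylor_on_lines (a i) x0 rho M.
  by have [r0 ? ?] := analytic_line_taylor (aO i x0 Ox0); exists r0.
have [r rP] := choice ex_r.
have /nbhs_ballP[e /= e0 eO] : nbhs x0 Omega by exact: open_nbhs_nbhs.
(* One radius serves Omega and all coefficients; a half-length rho / 4 for the
   lines and points at distance rho / 16 from x0 keep everything in the cube. *)
pose rho := Num.min (e / 2) (\big[Num.min/1]_i r i).
have rho0 : 0 < rho.
  rewrite lt_min divr_gt0 //=; apply: lt_bigmin => // i _.
  by have [] := rP i.
have rho_e : rho <= e / 2 by rewrite ge_min lexx.
have rho1 : rho <= 1 by rewrite ge_min bigmin_le_id orbT.
have rho_r i : rho <= r i by rewrite ge_min bigmin_le orbT.
clearbody rho.
have ex_M i : exists M : R, taylor_on_lines (a i) x0 rho M.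
  by have [_] := rP i; apply; rewrite rho0 rho_r.
have [Mi MiP] := choice ex_M.
pose M := \sum_i Mi i.
have M0 : 0 <= M by apply: sumr_ge0 => i _; have [] := MiP i.
have MiM i : Mi i <= M.
  by rewrite /M (bigD1 i) //= lerDl; apply: sumr_ge0 => j _; have [] := MiP j.
have in_Omega (x : 'rV[R]_n) : (forall i, `|x 0 i - x0 0 i| <= rho) -> Omega x.
  move=> xr; apply: eO; split => // i j; rewrite ord1 /ball /= distrC.
  by have := xr j; clear -rho0 rho_e e0; lra.
pose l x := ordered_root (Lambda x).
have lP x : Omega x -> nondecreasing_upto d (l x) /\ monic_family a x = poly_of_roots d (l x).
  move=> Ox; apply: ordered_roots_product (LO x Ox); first exact: monic_family_monic.
  exact: size_monic_family.
pose B := 1 + d.+1%:R * (M + 1).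
have B1 : 1 <= B by rewrite lerDl mulr_ge0 // addr_ge0.
have lB (x : 'rV[R]_n) k : (forall i, `|x 0 i - x0 0 i| <= rho) -> (k < d)%N -> `|l x k| <= B.
  move=> xr kd; have [_ E] := lP x (in_Omega x xr).
  have rk : (monic_family a x).[l x k] = 0.
    by rewrite E horner_poly_of_roots (bigD1 (Ordinal kd)) //= subrr mul0r.
  have := cauchy_boundP (monic_neq0 (monic_family_monic a x)) rk.
  move=> /ltW h; apply: (le_trans h); rewrite /cauchy_bound lerD2l.
  rewrite (monicP (monic_family_monic a x)) normr1 invr1 mul1r size_monic_family.
  rewrite mulr_natl -[X in _ *+ X](card_ord d.+1) -sumr_const; apply: ler_sum => j _.
  have [jd|dj] := ltnP j d.
    have [i iE] := coef_monic_family_ord a jd; rewrite iE.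
    have [_ /(_ x xr) ai _] := MiP i; have := MiM i.
    by move: ai; clear; lra.
  by rewrite coef_monic_family ltnNge dj /= normr_nat; case: eqP => _ /=; clear -M0; lra.
pose tau := rho / 2.
have tau0 : 0 < tau by rewrite divr_gt0.
pose M' := M / tau ^+ d.+1.
have M'0 : 0 <= M' by rewrite divr_ge0 // exprn_ge0 // ltW.
have sT : 0 < rho / 8 < rho / 4 by clear -rho0; apply/andP; split; lra.
have T1 : rho / 4 <= 1 by clear -rho0 rho1; lra.
have [L L1 lip] := lipschitz_roots (ltnSn d) B1 M'0 sT T1.
exists (rho / 16), L; split=> [|i x y _ _ xr yr]; first by rewrite divr_gt0.
have [/eqP xy|xy] := boolP (enorm (x - y) == 0).
  have -> : x = y.
    apply/rowP => j; apply/eqP; rewrite -subr_eq0 -normr_eq0 eq_le normr_ge0 andbT.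
    by have := coef_le_enorm (x - y) j; rewrite xy !mxE.
  by rewrite subrr normr0 mulr_ge0 ?sqrtr_ge0 // (le_trans ler01).
set h := enorm (x - y) in xy *.
have h0 : 0 < h by rewrite lt_def xy sqrtr_ge0.
have hs : h <= rho / 8.
  have -> : rho / 8 = 2 * (rho / 16) by field.
  have -> : h = enorm ((x - x0) - (y - x0)) by rewrite opprB addrA subrK.
  exact: enorm_sub_lt.
pose v := h^-1 *: (y - x).
have v1 j : `|v 0 j| <= 1.
  rewrite mxE normrM normfV (gtr0_norm h0) mulrC ler_pdivrMr // mul1r.
  have := coef_le_enorm (x - y) j; rewrite !mxE -/h distrC.
  by [].
have xhv : x + h *: v = y by rewrite scalerA mulfV // scale1r addrC subrK.
clearbody v.
have line (t : R) : `|t| <= rho / 4 -> forall j, `|(x + t *: v - x0) 0 j| <= rho / 2.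
  move=> tT j; have := coef_le_enorm (x - x0) j; rewrite !mxE => xj.
  have tv : `|t * v 0 j| <= rho / 4 by rewrite normrM (le_trans _ tT) // ler_piMr.
  have -> : x 0 j + t * v 0 j - x0 0 j = (x 0 j - x0 0 j) + t * v 0 j by ring.
  have := ler_normD (x 0 j - x0 0 j) (t * v 0 j).
  by move: xj xr tv; clear -rho0; lra.
have line_rho (t : R) : `|t| <= rho / 4 -> forall j, `|(x + t *: v) 0 j - x0 0 j| <= rho.
  by move=> tT j; have := line t tT j; rewrite !mxE; clear -rho0; lra.
have lineP (t : R) : `|t| <= rho / 4 -> nondecreasing_upto d (l (x + t *: v)) /\
    monic_family a (x + t *: v) = poly_of_roots d (l (x + t *: v)).
  by move=> tT; apply: lP; apply: in_Omega; apply: line_rho.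
have := lip (fun t => l (x + t *: v)) _ _ i 0 h (ltn_ord i).
rewrite normr0 (gtr0_norm h0) sub0r normrN (gtr0_norm h0) scale0r addr0.
rewrite xhv /l !ordered_root_ord; apply => //; last by clear -rho0; lra.
- move=> t tT; split; first by have [] := lineP t tT.
  by move=> k kd; apply: lB => //; apply: line_rho.
move=> k t0 t0T.
have tb0 (t : R) : 0 <= M' * `|t - t0| ^+ d.+1 by rewrite mulr_ge0 // exprn_ge0.
have [kd|dk] := ltnP k d; last first.
  exists ((k == d)%:R)%:P; first by rewrite (leq_trans (size_polyC_leq1 _)).
  move=> t tT; have [_ <-] := lineP t tT.
  by rewrite coef_monic_family ltnNge dk /= hornerC subrr normr0.
have [j jE] := coef_monic_family_ord a kd.
have [_ _ taylor] := MiP j.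
have [g sg gP] := taylor d.+1 (x + t0 *: v - x0) v (line t0 t0T) v1.
exists g => // t tT; have [_ <-] := lineP t tT; rewrite jE.
have ht : `|t - t0| <= rho / 2.
  by have := ler_normB t t0; move: tT t0T; clear; lra.
have := gP (t - t0) ht.
have -> : x0 + (x + t0 *: v - x0 + (t - t0) *: v) = x + t *: v.
  by rewrite addrC -addrA addrAC -!addrA [in LHS]scalerBl; apply/rowP => q; rewrite !mxE; ring.
move=> le; apply: (le_trans le).
have -> : M' * `|t - t0| ^+ d.+1 = M * (`|t - t0| / tau) ^+ d.+1.
  by rewrite /M' [RHS](congr1 _ (expr_div_n _ _ _)) mulrAC mulrA.
by rewrite ler_wpM2r // exprn_ge0 // divr_ge0 // ltW.
Qed.
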